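(* For every $\epsilon\in(0,1)$, as $n\to\infty$, $$-\log\beta_\epsilon(W_1^{\times n}\times P_1\|W_0^{\times n}\times P_0)=nD(W_1\|W_0)+\sqrt n\,\sqrt{\frac{d^2\phi}{d\theta^2}(1)}\;\Phi^{-1}(\epsilon)+o(\sqrt n).$$
   Context: $\mathcal X$ is a finite set. A transition matrix $W$ on $\mathcal X$ has entries $W(x|\bar x)\ge0$ with $\sum_xW(x|\bar x)=1$ for each $\bar x$. $W_0\ne W_1$ are irreducible and ergodic (i.e. irreducible and aperiodic) transition matrices on $\mathcal X$ with the same support; $P_0,P_1$ are probability distributions on $\mathcal X$ with the same support. $W_i^{\times n}\times P_i$ is the distribution on $\mathcal X^{n+1}$ of the Markov chain $(X_1,\dots,X_{n+1})$ with $X_1\sim P_i$ and $\Pr(X_{k+1}=x|X_k=\bar x)=W_i(x|\bar x)$. For distributions $Q_1,Q_0$ on the same finite set, $\beta_\epsilon(Q_1\|Q_0):=\min_T\{\mathsf E_{Q_0}[1-T]\mid\mathsf E_{Q_1}[T]\le\epsilon\}$, the minimum being over all $[0,1]$-valued functions $T$ (randomized tests). $\phi(\theta)$ is the logarithm of the Perron-Frobenius eigenvalue of the matrix $W_0(x|\bar x)^{1-\theta}W_1(x|\bar x)^{\theta}$ (zero outside the common support), i.e. of $W_0(x|\bar x)e^{\theta g(x,\bar x)}$ with $g=\log(W_1/W_0)$. $D(W_1\|W_0):=\frac{d}{ds}\varphi(1+s)|_{s=0}$, where $\varphi(1+s)$ is the logarithm of the Perron-Frobenius eigenvalue of the matrix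 $W_1(x|\bar x)^{1+s}W_0(x|\bar x)^{-s}$. $\Phi(y):=\int_{-\infty}^y\frac{e^{-x^2/2}}{\sqrt{2\pi}}dx$. *)

(* Defs.v *)
From HB Require Import structures.
From mathcomp Require Import all_boot all_order all_algebra.
From mathcomp Require Import complex.
From mathcomp Require Import all_classical all_reals all_analysis.

Set Implicit Arguments.
Unset Strict Implicit.
Unset Printing Implicit Defensive.

Import Order.TTheory GRing.Theory Num.Theory.
Import numFieldNormedType.Exports.

Local Open Scope classical_set_scope.
Local Open Scope ring_scope.

Section FiniteDistributions.
Context {R : realType}.

Definition is_distribution (Y : finType) (Q : Y -> R) : Prop :=
  (forall y, 0 <= Q y) /\ \sum_y Q y = 1.

Definition same_support (T : Type) (f g : T -> R) : Prop :=
  forall t, (f t != 0) = (g t != 0).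

Definition is_test (Y : finType) (T : Y -> R) : Prop :=
  forall y, 0 <= T y <= 1.

(* The infimum is a minimum: the constraint set is compact. *)
Definition beta (Y : finType) (eps : R) (Q1 Q0 : Y -> R) : R :=
  inf [set b | exists T : Y -> R,
    [/\ is_test T, \sum_y Q1 y * T y <= eps &
        b = \sum_y Q0 y * (1 - T y)]].

End FiniteDistributions.

Section TransitionMatrices.
Context {R : realType} {X : finType}.
Implicit Types (A W : X -> X -> R).

(* [W x xb] is W(x|xb): the first argument is the next state, the second one
   the current state. *)
Definition is_transition_matrix W : Prop :=
  (forall x xb, 0 <= W x xb) /\ (forall xb, \sum_x W x xb = 1).

Definition same_support2 (A B : X -> X -> R) : Prop :=
  forall x xb, (A x xb != 0) = (B x xb != 0).

Definition mx_of A : 'M[R]_#|X| :=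
  \matrix_(i, j) A (enum_val i) (enum_val j).

(* [n_step W n x xb] is W^n(x|xb). *)
Definition n_step W (n : nat) (x xb : X) : R :=
  (mx_of W ^+ n) (enum_rank x) (enum_rank xb).

Definition irreducible W : Prop :=
  forall x xb, exists2 n, (0 < n)%N & 0 < n_step W n x xb.

(* For every state x, the gcd of the possible return times to x is 1. *)
Definition aperiodic W : Prop :=
  forall (x : X) (d : nat),
    (forall n, (0 < n)%N -> 0 < n_step W n x x -> (d %| n)%N) -> d = 1%N.

Definition ergodic W : Prop := irreducible W /\ aperiodic W.

(* W^{x n} x P, the law of (X_1, ..., X_{n+1}), with indices shifted to
   0, ..., n. *)
Definition markov_law W (P : X -> R) (n : nat)
    (s : {ffun 'I_n.+1 -> X}) : R :=
  P (s ord0) *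
  \prod_(k < n) W (s (lift ord0 k)) (s (widen_ord (leqnSn n) k)).

(* A real eigenvalue dominating the modulus of all complex eigenvalues; it is
   unique if it exists. *)
Definition is_perron_frobenius (m : nat) (M : 'M[R]_m) (r : R) : Prop :=
  eigenvalue M r /\
  forall z : R[i], eigenvalue (map_mx (real_complex R) M) z ->
    `|z| <= real_complex R r.

Definition perron_frobenius A : R :=
  xget 0 [set r | is_perron_frobenius (mx_of A) r].

(* A(x|xb)^a * B(x|xb)^b on the common support and 0 elsewhere; the test is
   needed since [0 `^ 0 = 1]. *)
Definition tilted A (a : R) B (b : R) : X -> X -> R := fun x xb =>
  if (A x xb != 0) && (B x xb != 0) then A x xb `^ a * B x xb `^ b else 0.

Definition phi W0 W1 (theta : R) : R :=
  ln (perron_frobenius (tilted W0 (1 - theta) W1 theta)).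

(* [rel_entropy W1 W0] is D(W1||W0); [s |-> varphi(1+s)] is differentiated
   at 0. *)
Definition rel_entropy W1 W0 : R :=
  derive1 (fun s : R => ln (perron_frobenius (tilted W1 (1 + s) W0 (- s)))) 0.

End TransitionMatrices.

Arguments markov_law {R X} W P n s.

Section Gaussian.
Context {R : realType}.

Definition Phi (y : R) : R :=
  \int[lebesgue_measure]_(x in `]-oo, y])
    (expR (- x ^+ 2 / 2) / Num.sqrt (2 * pi)).

Definition Phi_inv (eps : R) : R := xget 0 [set y | Phi y = eps].

End Gaussian.

(* Main.v *)
Require Import Defs.
From HB Require Import structures.
From mathcomp Require Import all_boot all_order all_algebra.
From mathcomp Require Import complex.
From mathcomp Require Import all_classical all_reals all_analysis.
From mathcomp Require Import ring lra.

(* With g = log(W1/W0), the log-likelihood ratio of the two path laws is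
   L_n = log(P1/P0)(X_1) + sum_k g(X_{k+1}, X_k), so the Neyman-Pearson bounds
   locate -log beta_eps at the eps-quantile of L_n under W1, up to an additive
   constant.  The theorem is thus a central limit theorem for L_n together with
   the identification of its drift and variance with phi'(1) and phi''(1).

   Perturbing the Perron eigenvectors of W1 e^{(theta-1) g} gives
   D = phi'(1) = pi g and shows that the derivative h of the left eigenvector
   at theta = 1 solves the Poisson equation, so that
   m(x, xb) = g(x, xb) - D + h(x) - h(xb) is a martingale increment of
   stationary variance phi''(1).

   The limit theorem is a Lindeberg argument with the explicit test function
   (s, z) |-> Phi((y - z)/sqrt s).  It solves the heat equation, so running time
   backwards along the chain makes its expectation constant up to
   O(n^(-1/2)), without any characteristic functions.  Starting the heat flow at a
   small positive time also covers a vanishing variance. *)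

Set Implicit Arguments.
Unset Strict Implicit.
Unset Printing Implicit Defensive.

Import Order.TTheory GRing.Theory Num.Theory.
Import numFieldNormedType.Exports.

Local Open Scope classical_set_scope.
Local Open Scope ring_scope.

(** * Perron-Frobenius theory *)

(** The second derivative of [phi] at 1 needs the first one on a whole neighbourhood, while the
    eigenvectors are picked arbitrarily at each parameter and come with no regularity. Normalising
    them against a fixed positive vector makes them bounded. Exact difference formulas, with no
    remainder, then give first continuity and next differentiability; the inverse they need is that
    of the bordered matrix [A - r%:M + v *m u]. The first derivative is a quotient of bilinear
    expressions in the left and right eigenvectors, so differentiating it at 1 only uses the
    derivatives of the eigenvectors at 1. The conditional variance of the martingale increment
    depends on the current state. A second Poisson equation, with solution [h2] and the same
    bordered inverse, trades it for its stationary mean; without it the errors of the Lindeberg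
    steps would be of order 1/n each and would not sum to something small. *)

Lemma cvg_finsum (R : realType) (I : finType) (T : Type) (F : set_system T)
    {FF : Filter F} (f : I -> T -> R) (a : I -> R) :
  (forall i, f i t @[t --> F] --> a i) ->
  \sum_i f i t @[t --> F] --> \sum_i a i.
Proof. by move=> fa; apply: cvg_big => [|i _]; [exact: add_continuous|exact: fa]. Qed.

Section NonnegativeMatrices.
Context {R : realType} {n : nat}.
Implicit Types (A B : 'M[R]_n) (u w x : 'rV[R]_n).

Definition nneg_mx m k (A : 'M[R]_(m, k)) := forall i j, 0 <= A i j.
Definition pos_mx m k (A : 'M[R]_(m, k)) := forall i j, 0 < A i j.
Definition irreducible_mx A :=
  forall i j, exists2 k, (0 < k)%N & 0 < (A ^+ k) i j.

Lemma nneg_mxX A k : nneg_mx A -> nneg_mx (A ^+ k).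
Proof.
move=> A0; elim: k => [|k IH] i j.
  by rewrite expr0 mxE; case: eqP.
rewrite exprS -mulmxE mxE; apply: sumr_ge0 => l _; apply: mulr_ge0 => //; exact: IH.
Qed.

Lemma irreducible_mx_tr A : irreducible_mx A -> irreducible_mx A^T.
Proof.
have trX k : (A ^+ k)^T = A^T ^+ k.
  elim: k => [|k IH]; first by rewrite !expr0 trmx1.
  by rewrite exprS exprSr -IH -!mulmxE -trmx_mul.
by move=> irrA i j; have [k k0 h] := irrA j i; exists k => //; rewrite -trX mxE.
Qed.

Lemma mulmxX_eigen A u r k : u *m A = r *: u -> u *m A ^+ k = r ^+ k *: u.
Proof.
move=> uA; elim: k => [|k IH]; first by rewrite !expr0 mulmx1 scale1r.
by rewrite exprS -mulmxE mulmxA uA -scalemxAl IH scalerA -exprS.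
Qed.

(* A sum of powers of [A] commutes with [A], preserves its eigenvectors, and
   turns nonzero nonnegative vectors into positive ones. *)
Lemma irreducible_mx_sumX A : nneg_mx A -> irreducible_mx A ->
  exists N, pos_mx (\sum_(k < N) A ^+ k).
Proof.
move=> A0 irrA.
pose k (ij : 'I_n * 'I_n) := projT1 (cid2 (irrA ij.1 ij.2)).
exists (\max_ij k ij).+1 => i j; rewrite summxE.
have kl : (k (i, j) < (\max_ij k ij).+1)%N by rewrite ltnS; exact: leq_bigmax.
rewrite (bigD1 (Ordinal kl)) //= ltr_pwDl //.
  by rewrite /k; case: cid2.
by apply: sumr_ge0 => l _; exact: nneg_mxX.
Qed.

Lemma nneg_mulmx_pos u B : pos_mx B -> nneg_mx u -> u != 0 -> pos_mx (u *m B).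
Proof.
move=> B0 u0 un0 i j; rewrite mxE ord1.
have [k uk] : exists k, u 0 k != 0.
  apply/existsP; apply: contra_neqT un0 => /existsPn h.
  by apply/rowP => k; rewrite mxE; apply/eqP; move: (h k); rewrite negbK.
rewrite (bigD1 k) //= ltr_pwDl //.
  by rewrite mulr_gt0 // lt_def uk u0.
by apply: sumr_ge0 => l _; rewrite mulr_ge0 // ltW.
Qed.

Lemma mulmx_sumX A u N : u *m A *m (\sum_(k < N) A ^+ k) =
  u *m (\sum_(k < N) A ^+ k) *m A.
Proof.
rewrite -!mulmxA; congr (_ *m _); rewrite !mulmxE.
by apply: commr_sum => k _; exact: commrX.
Qed.

Lemma pos_scale_le (I : finType) (y w : I -> R) :
  (forall j, 0 < y j) -> (forall j, 0 < w j) ->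
  exists2 e, 0 < e & forall j, e * y j <= w j.
Proof.
move=> y0 w0; pose S := 1 + \sum_j y j / w j.
have S0 : 0 < S.
  by rewrite ltr_pwDl // sumr_ge0 // => j _; rewrite divr_ge0 ?ltW.
exists S^-1; first by rewrite invr_gt0.
move=> j; rewrite mulrC ler_pdivrMr // mulrC -ler_pdivrMr //.
rewrite /S (bigD1 j) //= addrCA lerDl addr_ge0 // sumr_ge0 // => k _.
by rewrite divr_ge0 ?ltW.
Qed.

Definition simplex := [set u : 'rV[R]_n | nneg_mx u /\ \sum_j u 0 j = 1].

Lemma compact_simplex : compact simplex.
Proof.
pose f (u : 'rV[R]_n) := \sum_j u 0 j.
have cf : continuous f.
  apply: continuous_big => [|j _]; first exact: add_continuous.
  exact: coord_continuous.
rewrite (_ : simplex = [set v : 'rV[R]_n | forall i, `[0%R, 1%R]%classic (v ord0 i)]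
   `&` f @^-1` [set 1]).
  apply: compact_closedI.
    by apply: (@rV_compact R n (fun=> `[0%R, 1%R]%classic)) => _; exact: segment_compact.
  by apply: preimage_closed => [x _|]; [exact: cf|exact: closed_eq].
apply/seteqP; split => [u [u0 u1]|u [u0 u1]]; split => //.
- move=> i /=; rewrite in_itv /= u0 /= -u1 (bigD1 i) //= lerDl.
  by apply: sumr_ge0 => *; exact: u0.
- by move=> i j; rewrite ord1; have /= := u0 j; rewrite in_itv /= => /andP[].
Qed.

(* Collatz-Wielandt: the largest [r] such that [r *: u <= u *m A] for some
   nonnegative [u != 0] is an eigenvalue. *)
Lemma perron_left A : (0 < n)%N -> nneg_mx A -> irreducible_mx A ->
  exists r u, [/\ 0 < r, pos_mx u & u *m A = r *: u].
Proof.
move=> n0 A0 irrA; have [N B0] := irreducible_mx_sumX A0 irrA.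
set B := \sum_(k < N) A ^+ k in B0.
pose E := [set r : R | 0 <= r /\
  exists2 u, simplex u & forall j, r * u 0 j <= (u *m A) 0 j].
pose i0 := Ordinal n0.
have simp0 : simplex !=set0.
  exists (delta_mx 0 i0); split=> [i j|]; first by rewrite mxE ler0n.
  rewrite (bigD1 i0) //= mxE !eqxx big1 ?addr0 // => j /negPf ji.
  by rewrite mxE ji andbF.
have E0 : E 0.
  split=> //; have [u su] := simp0; exists u => // j.
  rewrite mul0r mxE sumr_ge0 // => k _; apply: mulr_ge0 => //; exact: su.1.
have Eub : has_ubound E.
  exists (\sum_j \sum_i A i j) => r [r0 [u [u0 u1] h]].
  rewrite -[r]mulr1 -u1 mulr_sumr; apply: ler_sum => j _.
  apply: (le_trans (h j)); rewrite mxE; apply: ler_sum => i _.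
  rewrite ler_piMl // -u1 (bigD1 i) //= lerDl sumr_ge0 // => k _; exact: u0.
pose rs := sup E.
have rs_ge r : E r -> r <= rs by exact: ub_le_sup.
have rs0 : 0 <= rs by exact: rs_ge.
(* Twice the positive part: [F r u] vanishes exactly when [r *: u <= u *m A] entrywise, so
   attainment of the supremum becomes the minimisation of a continuous function on a compact set. *)
pose pp (t : R) := `|t| + t.
pose F r (u : 'rV[R]_n) := \sum_j pp (r * u 0 j - (u *m A) 0 j).
have cF : continuous (F rs).
  apply: continuous_big => [|j _]; first exact: add_continuous.
  have cg : continuous (fun u : 'rV[R]_n => rs * u 0 j - (u *m A) 0 j).
    move=> u; have FF : Filter (nbhs u) by exact: nbhs_filter.
    apply: (@cvgB _ _ _ (nbhs u)); first by apply: cvgMl_tmp; exact: coord_continuous.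
    rewrite [X in _ --> X]mxE; under eq_cvg do rewrite mxE.
    by apply: cvg_finsum => i; apply: cvgMr_tmp; exact: coord_continuous.
  move=> u; apply: (@cvgD _ _ _ (nbhs u)); last exact: cg.
  by apply: (@cvg_norm _ _ _ (nbhs u)); exact: cg.
have pp_ge0 t : 0 <= pp t by rewrite /pp; have := ler_norm (- t); rewrite normrN; lra.
have ppE t : (pp t == 0) = (t <= 0).
  rewrite /pp; case: (ltrP 0 t) => t0; last by rewrite ler0_norm // addNr eqxx.
  by rewrite gtr0_norm //; apply/negbTE; rewrite gt_eqF // addr_gt0.
have [us /set_mem sus usmin] := EVT_min_rV simp0 compact_simplex (continuous_subspaceT cF).
have Fus : F rs us = 0.
  apply/eqP; rewrite eq_le [X in _ && X]sumr_ge0 ?andbT //.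
  (* Some [r] in [E] lies within [F rs us / 2] of the supremum; its witness [u] has
     [F rs u <= 2 * (rs - r)], which is below the minimum. *)
  rewrite leNgt; apply/negP => F0.
  have F20 : 0 < F rs us / 2 by rewrite divr_gt0.
  have [r Er rl] := sup_adherent F20 (conj (ex_intro _ 0 E0) Eub).
  have [r0 [u su ur]] := Er.
  have := usmin u (mem_set su); apply/negP; rewrite -ltNge.
  apply: (@le_lt_trans _ _ (2 * (rs - r))); last by rewrite -/rs in rl; lra.
  have -> : 2 * (rs - r) = \sum_j 2 * (rs - r) * u 0 j by rewrite -mulr_sumr su.2 mulr1.
  apply: ler_sum => j _.
  have := ur j; have := su.1 0 j; set a := u 0 j; set b := (_ *m _) _ _ => a0 ab.
  have rrs := rs_ge _ Er.
  have h0 : 0 <= (rs - r) * a by rewrite mulr_ge0 // subr_ge0.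
  rewrite -mulrA; rewrite !mulrBl in h0 *; move: h0 ab.
  rewrite /pp; move: (rs * a) (r * a) => ra1 ra2 h0 ab.
  by case: (ler0P (ra1 - b)) => _; lra.
have us_le j : rs * us 0 j <= (us *m A) 0 j.
  rewrite -subr_le0 -ppE; apply/eqP.
  exact: (psumr_eq0P (fun i _ => pp_ge0 _) Fus).
have usn0 : us != 0.
  apply/eqP => us0; have := sus.2; rewrite us0 big1 => [/eqP|j _]; last by rewrite mxE.
  by rewrite eq_sym oner_eq0.
have eig : us *m A = rs *: us.
  (* If the defect [w] were nonzero, multiplying by [B] would make the inequality strict in every
     coordinate and leave room to raise [rs] by some [e > 0]. *)
  apply/eqP; rewrite -subr_eq0; apply/negPn/negP => wn0.
  set w := us *m A - rs *: us in wn0.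
  have w0 : nneg_mx w by move=> i j; rewrite ord1 !mxE subr_ge0; have := us_le j; rewrite mxE.
  have wB := nneg_mulmx_pos B0 w0 wn0.
  have yB := nneg_mulmx_pos B0 sus.1 usn0.
  have [e e0 eyw] := pos_scale_le (yB 0) (wB 0).
  pose y := us *m B; pose s := \sum_j y 0 j.
  have s0 : 0 < s.
    rewrite /s (bigD1 i0) //= ltr_pwDl //.
    by apply: sumr_ge0 => j _; exact/ltW/yB.
  have : E (rs + e).
    split; first by rewrite addr_ge0 // ltW.
    exists (s^-1 *: y).
      split=> [i j|]; first by rewrite mxE mulr_ge0 ?invr_ge0 ?ltW // yB.
      by under eq_bigr do rewrite mxE; rewrite -mulr_sumr -/s mulVf // gt_eqF.
    move=> j; rewrite -scalemxAl !(mxE scalemx_key) mulrCA.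
    rewrite ler_pM2l ?invr_gt0 // mulrDl.
    have := eyw j; rewrite -/y.
    by rewrite mulmxBl mulmx_sumX -scalemxAl -/B -/y !mxE; lra.
  by move/rs_ge; rewrite gerDl leNgt e0.
have upos : pos_mx us.
  have := nneg_mulmx_pos B0 sus.1 usn0; rewrite mulmx_sumr.
  under eq_bigr do rewrite (mulmxX_eigen _ eig).
  rewrite -scaler_suml => h i j; have := h i j; rewrite mxE.
  rewrite lt_def mulf_eq0 negb_or => /andP[/andP[_ un0] _].
  by rewrite lt_def un0 sus.1.
exists rs, us; split=> //.
rewrite lt_def rs0 andbT; apply/eqP => r0.
have [k k0 Ak] := irrA i0 i0.
have := mulmxX_eigen k eig; rewrite r0 expr0n gtn_eqF // scale0r => /rowP /(_ i0).
rewrite !mxE => /eqP; rewrite gt_eqF // (bigD1 i0) //= ltr_pwDl ?mulr_gt0 //.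
by apply: sumr_ge0 => j _; apply: mulr_ge0; [exact/ltW/upos|exact: nneg_mxX].
Qed.

(** Subtract from [x] the largest multiple of [u] that keeps the difference nonnegative. The
    difference is an eigenvector vanishing at [j0], whereas a nonzero nonnegative one would be
    positive everywhere. *)
Lemma perron_simple A r u x : nneg_mx A -> irreducible_mx A ->
  0 <= r -> pos_mx u -> u *m A = r *: u -> x *m A = r *: x ->
  exists c, x = c *: u.
Proof.
move=> A0 irrA r0 u0 uA xA.
case: (posnP n) => [n0|n0].
  by exists 0; apply/rowP => j; have := ltn_ord j; rewrite [X in (_ < X)%N]n0.
have [N B0] := irreducible_mx_sumX A0 irrA.
pose i0 := Ordinal n0.
pose q j := x 0 j / u 0 j.
pose j0 := [arg min_(j < i0) q j]%O.
have qmin j : q j0 <= q j by rewrite /j0; case: arg_minP => // i _; exact.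
exists (q j0); apply/eqP; rewrite -subr_eq0; apply/negPn/negP => wn0.
set w := x - q j0 *: u in wn0.
have w0 : nneg_mx w.
  by move=> i j; rewrite ord1 !mxE subr_ge0 -ler_pdivlMr //; exact: qmin.
have wA : w *m A = r *: w.
  by rewrite mulmxBl -scalemxAl uA xA scalerBr !scalerA [_ * r]mulrC.
have := nneg_mulmx_pos B0 w0 wn0 0 j0; rewrite mulmx_sumr.
under eq_bigr do rewrite (mulmxX_eigen _ wA).
by rewrite -scaler_suml !mxE /q divfK ?subrr ?mulr0 ?ltxx // gt_eqF.
Qed.

End NonnegativeMatrices.

(** * Differentiability of the Perron eigenvalue *)

Lemma is_derive_cvg (R : realType) (f : R -> R) (s l : R) :
  h^-1 * (f (h + s) - f s) @[h --> 0^'] --> l -> is_derive s 1 f l.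
Proof.
move=> fl.
have E : (fun h : R => h^-1 *: ((f \o shift s) (h *: 1%R) - f s)) =
         (fun h => h^-1 * (f (h + s) - f s)).
  by apply/funext => h /=; rewrite [h *: 1]mulr1.
apply: DeriveDef; first by rewrite /derivable E; apply: cvgP fl.
by rewrite /derive E; apply/cvg_lim.
Qed.

Lemma cvg_is_derive (R : realType) (f : R -> R) (s l : R) :
  is_derive s 1 f l -> h^-1 * (f (h + s) - f s) @[h --> 0^'] --> l.
Proof.
move=> fl.
have E : (fun h : R => h^-1 *: ((f \o shift s) (h *: 1%R) - f s)) =
         (fun h => h^-1 * (f (h + s) - f s)).
  by apply/funext => h /=; rewrite [h *: 1]mulr1.
have := @ex_derive _ _ _ _ _ _ _ fl; rewrite /derivable E => cf.
by have <- := @derive_val _ _ _ _ _ _ _ fl; rewrite /derive E.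
Qed.

Lemma cvg_dnbhs_diff (R : realType) (f : R -> R) (s l : R) :
  is_derive s 1 f l -> f (h + s) - f s @[h --> 0^'] --> 0.
Proof.
move=> /cvg_is_derive fl.
have h0 : (h : R) @[h --> 0^'] --> 0.
  by move=> P P0; apply: (@cvg_within R (nbhs (0 : R))); exact: P0.
have /(_ _) h1 := cvgM h0 fl; rewrite mul0r in h1; apply: (cvg_trans _ h1).
apply: (@near_eq_cvg _ _ (0 : R)^'); near=> h; rewrite /= mulrA divff ?mul1r //.
by near: h; exact: nbhs_dnbhs_neq.
Unshelve. all: by end_near. Qed.

Section MatrixConvergence.
Context {R : realType}.
Local Notation F := ((0 : R)^').

Definition mx_cvg m n (B : R -> 'M[R]_(m, n)) (B0 : 'M[R]_(m, n)) :=
  forall i j, B t i j @[t --> F] --> B0 i j.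

Lemma mx_cvg_cst m n (B0 : 'M[R]_(m, n)) : mx_cvg (fun=> B0) B0.
Proof. by move=> i j; exact: cvg_cst. Qed.

Lemma mx_cvgM m n p (B : R -> 'M[R]_(m, n)) B0 (C : R -> 'M[R]_(n, p)) C0 :
  mx_cvg B B0 -> mx_cvg C C0 -> mx_cvg (fun t => B t *m C t) (B0 *m C0).
Proof.
move=> BB CC i j; rewrite mxE; under eq_cvg do rewrite mxE.
by apply: cvg_finsum => k; apply: cvgM; [exact: BB|exact: CC].
Qed.

Lemma mx_cvgD m n (B C : R -> 'M[R]_(m, n)) B0 C0 :
  mx_cvg B B0 -> mx_cvg C C0 -> mx_cvg (fun t => B t + C t) (B0 + C0).
Proof.
move=> BB CC i j; rewrite mxE; under eq_cvg do rewrite mxE.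
by apply: cvgD; [exact: BB|exact: CC].
Qed.

Lemma mx_cvgN m n (B : R -> 'M[R]_(m, n)) B0 :
  mx_cvg B B0 -> mx_cvg (fun t => - B t) (- B0).
Proof.
move=> BB i j; rewrite mxE; under eq_cvg do rewrite mxE.
by apply: cvgN; exact: BB.
Qed.

Lemma mx_cvg_scalar n (f : R -> R) a : f t @[t --> F] --> a ->
  mx_cvg (fun t => ((f t)%:M : 'M[R]_n)) a%:M.
Proof.
move=> fa i j; rewrite mxE; under eq_cvg do rewrite mxE.
by case: eqP => _; rewrite ?mulr1n ?mulr0n //; exact: cvg_cst.
Qed.

(** Only boundedness of [B] is asked, so this applies to the eigenvectors before their continuity is
    known. *)
Lemma mx_cvgM_bounded m n p (B : R -> 'M[R]_(m, n)) (C : R -> 'M[R]_(n, p)) c :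
  (forall t i j, `|B t i j| <= c) -> mx_cvg C 0 ->
  mx_cvg (fun t => B t *m C t) (0 : 'M[R]_(m, p)).
Proof.
move=> Bc C0 i j; rewrite (_ : (0 : 'M[R]_(m, p)) i j = \sum_(k < n) (0 : R)); last first.
  by rewrite mxE big1.
under eq_cvg do rewrite mxE.
apply: cvg_finsum => k; apply/cvgr0Pnorm_le => e e0.
have c1 : 0 < `|c| + 1 by rewrite ltr_pwDr.
have := C0 k j; rewrite mxE => /cvgr0Pnorm_le /(_ (e / (`|c| + 1))).
rewrite divr_gt0 // => /(_ isT); apply: filterS => t.
rewrite ler_pdivlMr // mulrC normrM => h; apply: le_trans h.
apply: ler_pM => //; apply: (le_trans (Bc _ _ _)).
by apply: (le_trans (ler_norm _)); rewrite lerDl.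
Qed.

End MatrixConvergence.

Arguments mx_cvg_cst {R m n} B0.

Section Perron.
Context {R : realType} {n : nat}.
Implicit Types (A : 'M[R]_n) (u : 'rV[R]_n) (v : 'cV[R]_n) (r : R).

Definition perron_pair A r u v :=
  [/\ pos_mx u, pos_mx v, u *m A = r *: u & A *m v = r *: v].

Lemma pos_mulmx_gt0 u v : (0 < n)%N -> pos_mx u -> pos_mx v -> 0 < (u *m v) 0 0.
Proof.
move=> n0 u0 v0; rewrite mxE (bigD1 (Ordinal n0)) //= ltr_pwDl ?mulr_gt0 //.
by apply: sumr_ge0 => i _; apply: mulr_ge0; exact/ltW.
Qed.

Lemma perron_exists A : (0 < n)%N -> nneg_mx A -> irreducible_mx A ->
  exists r u v, 0 < r /\ perron_pair A r u v.
Proof.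
move=> n0 A0 irrA; have [r [u [r0 u0 uA]]] := perron_left n0 A0 irrA.
have AT0 : nneg_mx A^T by move=> i j; rewrite mxE.
have [q [w [q0 w0 wA]]] := perron_left n0 AT0 (irreducible_mx_tr irrA).
have v0 : pos_mx w^T by move=> i j; rewrite mxE.
have Aw : A *m w^T = q *: w^T by rewrite -[A]trmxK -trmx_mul wA linearZ.
exists r, u, w^T; split => //; split => //; rewrite Aw; congr (_ *: _).
(* The left and right eigenvalues agree: evaluate [u *m A *m w^T] in both ways and cancel the
   positive pairing of [u] with [w^T]. *)
have := congr1 (mulmx u) Aw; rewrite mulmxA uA -scalemxAl -scalemxAr => /matrixP/(_ 0 0).
rewrite !(mxE scalemx_key) => /esym; apply: mulIf; rewrite gt_eqF //.
exact: pos_mulmx_gt0.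
Qed.

(** The rank-one border removes the kernel of [A - r%:M]. If [x] is killed, multiplying by [v] on
    the right gives [x *m v = 0], since [A - r%:M] kills [v] and [u *m v > 0]; then [x] is an
    eigenvector, hence a multiple of [u], and [x *m v = 0] makes it zero. *)
Lemma perron_border_unit A r u v : (0 < n)%N -> nneg_mx A -> irreducible_mx A ->
  0 <= r -> perron_pair A r u v -> A - r%:M + v *m u \in unitmx.
Proof.
move=> n0 A0 irrA r0 [u0 v0 uA Av].
have uv := pos_mulmx_gt0 n0 u0 v0.
rewrite -row_free_unit -kermx_eq0; apply/rowV0P => x /sub_kermxP.
rewrite mulmxDr mulmxBr mul_mx_scalar => xM.
have e : x *m v *m (u *m v) = 0.
  have := congr1 (mulmx^~ v) xM.
  by rewrite mul0mx mulmxDl mulmxBl -[x *m A *m v]mulmxA Av -scalemxAr -scalemxAl subrr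
     add0r !mulmxA.
have /eqP xv : x *m v == 0.
  by move/eqP: e; rewrite [u *m v]mx11_scalar mul_mx_scalar scaler_eq0 gt_eqF.
move: xM; rewrite mulmxA xv mul0mx addr0 => /eqP; rewrite subr_eq0 => /eqP xA.
have [c xc] := perron_simple A0 irrA r0 u0 uA xA.
move: xv; rewrite xc -scalemxAl => /matrixP/(_ 0 0).
rewrite mxE [RHS]mxE => /eqP; rewrite mulf_eq0 (gt_eqF uv) orbF => /eqP ->.
by rewrite scale0r.
Qed.

(** For a complex left eigenvector [w], take moduli in the eigenvalue equation and pair with the
    positive right eigenvector [v]; since [A *m v = r *: v], this bounds [|z|] by [r] after division
    by the weighted norm [a]. *)
Lemma perron_frobeniusP A r u v : (0 < n)%N -> nneg_mx A -> perron_pair A r u v ->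
  is_perron_frobenius A r.
Proof.
move=> n0 A0 [u0 v0 uA Av]; split.
  apply/eigenvalueP; exists u => //; apply/eqP => /matrixP/(_ 0 (Ordinal n0)).
  by rewrite mxE => /eqP; rewrite gt_eqF.
move=> z /eigenvalueP[w wA wn0].
pose C := real_complex R.
have Cle (a b : R) : (C a <= C b) = (a <= b) by rewrite lecR.
pose a := \sum_j `|w 0 j| * C (v j 0).
have [j wj] : exists j, w 0 j != 0.
  apply/existsP; apply: contra_neqT wn0 => /existsPn h.
  by apply/rowP => k; rewrite mxE; apply/eqP; move: (h k); rewrite negbK.
have Cv i : 0 < C (v i 0) by rewrite ltcR.
have a0 : 0 < a.
  rewrite /a (bigD1 j) //= ltr_pwDl //; first by rewrite mulr_gt0 ?normr_gt0.
  by apply: sumr_ge0 => i _; rewrite mulr_ge0 // ltW.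
rewrite -(ler_pM2r a0) mulr_sumr.
apply: (@le_trans _ _ (\sum_k (\sum_i `|w 0 i| * C (A i k)) * C (v k 0))).
  apply: ler_sum => k _; rewrite mulrA ler_pM2r // -normrM.
  have /rowP/(_ k) := wA; rewrite !mxE => <-.
  apply: (le_trans (ler_norm_sum _ _ _)); apply: ler_sum => i _.
  by rewrite normrM mxE; rewrite ler_wpM2l // ger0_norm // lecR.
under eq_bigr do rewrite mulr_suml.
rewrite exchange_big /= /a mulr_sumr; apply: ler_sum => i _.
under eq_bigr do rewrite -mulrA.
rewrite -mulr_sumr mulrCA ler_wpM2l //.
have /matrixP/(_ i 0) := Av; rewrite !mxE => e.
by rewrite -rmorphM /= -e rmorph_sum /=; under [leRHS]eq_bigr do rewrite rmorphM.
Qed.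

Lemma is_perron_frobenius_inj A r q :
  is_perron_frobenius A r -> is_perron_frobenius A q -> r = q.
Proof.
have ev s : eigenvalue A s -> eigenvalue (map_mx (real_complex R) A) (real_complex R s).
  by rewrite eigenvalue_map.
have le s t : is_perron_frobenius A s -> is_perron_frobenius A t -> s <= t.
  move=> [/ev es _] [_ /(_ _ es)]; rewrite normc_def /= => h.
  have := h; rewrite expr0n /= addr0 sqrtr_sqr lecR; exact/le_trans/ler_norm.
by move=> hr hq; apply/eqP; rewrite eq_le !le.
Qed.

End Perron.

Section Perturbation.
Context {R : realType} {n : nat}.
Variables (A : R -> 'M[R]_n) (lam : R -> R) (s : R) (A' : 'M[R]_n).
Variables (u : R -> 'rV[R]_n) (v : 'cV[R]_n).
Hypothesis n0 : (0 < n)%N.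
Hypothesis A0 : nneg_mx (A s).
Hypothesis irrA : irreducible_mx (A s).
Hypothesis dA : forall i j, is_derive s 1 (fun t => A t i j) (A' i j).
Hypothesis u0 : forall t, pos_mx (u t).
Hypothesis uA : forall t, u t *m A t = lam t *: u t.
Hypothesis uv : forall t, u t *m v = 1%:M.
Hypothesis v0 : pos_mx v.
Hypothesis Av : A s *m v = lam s *: v.
Hypothesis lam0 : 0 <= lam s.

Let dAt h := A (h + s) - A s.
Let dl h := lam (h + s) - lam s.

(** All terms of [u t *m v = 1] are positive, so each entry of [u t] is at most the inverse of an
    entry of [v]. *)
Let u_bounded : exists c, forall t i j, `|u t i j| <= c.
Proof.
exists (\sum_i (v i 0)^-1) => t k j; rewrite (ord1 k) ger0_norm; last exact/ltW/u0.
apply: (@le_trans _ _ (v j 0)^-1); last first.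
  by rewrite (bigD1 j) //= lerDl sumr_ge0 // => i _; rewrite invr_ge0 ltW.
rewrite -[leRHS]mul1r ler_pdivlMr //.
have /matrixP/(_ 0 0) := uv t; rewrite !mxE eqxx mulr1n => <-.
rewrite (bigD1 j) //= lerDl; apply: sumr_ge0 => i _; apply: mulr_ge0; [exact/ltW/u0|exact/ltW/v0].
Qed.

(** Pairing the left eigenvector at [h + s] with the right one at [s] gives the increment of the
    eigenvalue exactly. *)
Let dlE h : (dl h)%:M = u (h + s) *m (dAt h *m v) :> 'M[R]_1.
Proof.
rewrite mulmxA mulmxBr uA mulmxBl -scalemxAl -mulmxA Av -scalemxAr uv.
by rewrite -scalerBl scalemx1.
Qed.

Let M := A s - (lam s)%:M + v *m u s.

(** Both vectors pair to 1 with [v], so the border of [M] does not see their difference, and the two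
    eigenvalue equations give its product with [M]. *)
Let duE h : u (h + s) - u s = - (u (h + s) *m ((dAt h - (dl h)%:M) *m invmx M)).
Proof.
have Mu : M \in unitmx by apply: perron_border_unit => //; split.
apply: (can_inj (mulmxK Mu)).
rewrite mulNmx -!mulmxA mulVmx // mulmx1 /M mulmxDr mulmxA [(_ - _) *m v]mulmxBl !uv subrr.
rewrite mul0mx addr0 mulmxBl [u s *m _]mulmxBr uA mul_mx_scalar subrr subr0.
have -> : dAt h - (dl h)%:M =
    (A (h + s) - (lam (h + s))%:M) - (A s - (lam s)%:M).
  by rewrite raddfB /= !opprB addrACA [RHS]addrACA; congr (_ + _); exact: addrC.
by rewrite [u (h + s) *m (_ - _ - _)]mulmxBr [u (h + s) *m (A (h + s) - _)]mulmxBr uA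
   mul_mx_scalar subrr sub0r opprK.
Qed.

Let dAt0 : mx_cvg dAt 0.
Proof.
move=> i j; rewrite mxE; under eq_cvg do rewrite !mxE.
exact: cvg_dnbhs_diff (dA i j).
Qed.

Let dlQ h : h^-1 * dl h = (u (h + s) *m ((h^-1 *: dAt h) *m v)) 0 0.
Proof.
rewrite -scalemxAl -scalemxAr -dlE !mxE eqxx mulr1n //.
Qed.

Let dl0 : dl h @[h --> 0^'] --> 0.
Proof.
have [c uc] := u_bounded.
have h1 := mx_cvgM dAt0 (mx_cvg_cst v); rewrite mul0mx in h1.
have := mx_cvgM_bounded (fun h => uc (h + s)) h1.
move=> /(_ 0 0); rewrite mxE; under eq_cvg do rewrite -dlE mxE eqxx mulr1n; exact.
Qed.

Let u_cvg : mx_cvg (fun h => u (h + s)) (u s).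
Proof.
have [c uc] := u_bounded.
have h1 := mx_cvgM (mx_cvgD dAt0 (mx_cvgN (mx_cvg_scalar (n := n) dl0)))
  (mx_cvg_cst (invmx M)).
rewrite raddf0 oppr0 addr0 mul0mx in h1.
have h2 := mx_cvgN (mx_cvgM_bounded (fun h => uc (h + s)) h1).
have := mx_cvgD (mx_cvg_cst (u s)) h2; rewrite oppr0 addr0.
move=> h3 i j; have := h3 i j.
by under eq_cvg do rewrite -duE addrC subrK.
Qed.

Let QA : mx_cvg (fun h => h^-1 *: dAt h) A'.
Proof.
move=> i j; under eq_cvg do rewrite !mxE; exact: cvg_is_derive.
Qed.

Definition perron_lam' := (u s *m (A' *m v)) 0 0.

Lemma perron_is_derive : is_derive s 1 lam perron_lam'.
Proof.
apply: is_derive_cvg; under eq_cvg do rewrite -/(dl _) dlQ.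
exact: (mx_cvgM u_cvg (mx_cvgM QA (mx_cvg_cst v))).
Qed.

(** The candidate [du] is the limit of [duE] divided by [h]. It pairs to 0 with [v] because the
    normalisation is constant; the last equation is the differentiated eigenvalue equation. *)
Lemma perron_vec_is_derive : exists du : 'rV[R]_n,
  [/\ forall j, is_derive s 1 (fun t => u t 0 j) (du 0 j),
      du *m v = 0 &
      du *m A s + u s *m A' = perron_lam' *: u s + lam s *: du].
Proof.
have Mu : M \in unitmx by apply: perron_border_unit => //; split.
pose du := - (u s *m ((A' - perron_lam'%:M) *m invmx M)).
have duM : du *m M = - (u s *m (A' - perron_lam'%:M)).
  by rewrite mulNmx -!mulmxA mulVmx // mulmx1.
have duv : du *m v = 0.
  have Mv : M *m v = v.
    by rewrite mulmxDl mulmxBl Av mul_scalar_mx subrr add0r -mulmxA uv mulmx1.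
  rewrite -Mv mulmxA duM mulNmx -mulmxA mulmxBl mulmxBr mul_scalar_mx -scalemxAr uv.
  by rewrite [u s *m _]mx11_scalar -/perron_lam' scalemx1 subrr oppr0.
exists du; split => //.
  move=> j; apply: is_derive_cvg.
  have := mx_cvgN (mx_cvgM u_cvg (mx_cvgM
    (mx_cvgD QA (mx_cvgN (mx_cvg_scalar (n := n) (cvg_is_derive perron_is_derive))))
    (mx_cvg_cst (invmx M)))).
  move=> /(_ 0 j) h2; apply: (cvg_trans _ h2); apply: (@near_eq_cvg _ _ (0 : R)^').
  near=> h.
  have -> : h^-1 * (u (h + s) 0 j - u s 0 j) = (h^-1 *: (u (h + s) - u s)) 0 j.
    by rewrite !mxE.
  rewrite duE scalerN scalemxAr scalemxAl.
  by rewrite [h^-1 *: (dAt h - _)]scalerBr scale_scalar_mx.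
move: duM; rewrite /M mulmxDr mulmxA duv mul0mx addr0 mulmxBr mul_mx_scalar mulmxBr.
rewrite mul_mx_scalar opprB => /eqP; rewrite subr_eq => /eqP ->.
by rewrite addrAC subrK.
Unshelve. all: by end_near. Qed.

End Perturbation.

Lemma is_derive_finsum (R : realType) (n : nat) (f : 'I_n -> R -> R) (df : 'I_n -> R) (s : R) :
  (forall i, is_derive s 1 (f i) (df i)) ->
  is_derive s 1 (fun t => \sum_i f i t) (\sum_i df i).
Proof.
move=> h; have := is_derive_sum h; congr (is_derive _ _ _ _).
by apply/funext => t; rewrite fct_sumE.
Qed.

Lemma is_derive_mulr (R : realType) (f g : R -> R) (s df dg : R) :
  is_derive s 1 f df -> is_derive s 1 g dg ->
  is_derive s 1 (fun t => f t * g t) (df * g s + f s * dg).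
Proof.
move=> hf hg; apply: (is_derive_eq (is_deriveM hf hg)).
by rewrite ![_ *: _]mulrC [_ * f s]mulrC addrC.
Qed.

Lemma is_derive_divr (R : realType) (f g : R -> R) (s df dg : R) : g s != 0 ->
  is_derive s 1 f df -> is_derive s 1 g dg ->
  is_derive s 1 (fun t => f t / g t) ((df * g s - f s * dg) / g s ^+ 2).
Proof.
move=> g0 hf hg; have hV := is_deriveV (f := g) g0 hg.
apply: (is_derive_eq (is_derive_mulr hf hV)).
by rewrite [_ *: _]mulNr; field.
Qed.

Lemma is_derive_derive1 (R : realType) (f : R -> R) (s l : R) :
  is_derive s 1 f l -> derive1 f s = l.
Proof. by move=> h; rewrite derive1E derive_val. Qed.

Lemma is_derive_comp (R : realType) (f g : R -> R) (s df dg : R) :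
  is_derive (g s) 1 f df -> is_derive s 1 g dg ->
  is_derive s 1 (fun t => f (g t)) (df * dg).
Proof. exact: is_derive1_comp. Qed.

Lemma mx11_normalize (R : fieldType) (a : 'M[R]_1) :
  a 0 0 != 0 -> (a 0 0)^-1 *: a = 1%:M.
Proof. by move=> a0; apply/matrixP => i j; rewrite !ord1 !mxE mulVf ?eqxx. Qed.

Section PerronDerivative.
Context {R : realType} {n : nat}.
Implicit Types (A : R -> 'M[R]_n).

(** Rescaling [u] inside the proof lets one fixed family of left eigenvectors serve at every [s],
    each time with a right eigenvector at that point. *)
Lemma perron_is_derive_gen A (A' : 'M[R]_n) (lam : R -> R) (s : R)
    (u : R -> 'rV[R]_n) (v : 'cV[R]_n) :
  (0 < n)%N -> nneg_mx (A s) -> irreducible_mx (A s) ->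
  (forall i j, is_derive s 1 (fun t => A t i j) (A' i j)) ->
  (forall t, pos_mx (u t)) -> (forall t, u t *m A t = lam t *: u t) ->
  pos_mx v -> A s *m v = lam s *: v -> 0 <= lam s ->
  is_derive s 1 lam ((u s *m (A' *m v)) 0 0 / (u s *m v) 0 0).
Proof.
move=> n0 A0 irrA dA u0 uA v0 Av lam0.
have uv0 t : 0 < (u t *m v) 0 0 by exact: pos_mulmx_gt0.
pose w t := ((u t *m v) 0 0)^-1 *: u t.
have w0 t : pos_mx (w t) by move=> i j; rewrite mxE mulr_gt0 ?invr_gt0 //; exact: u0.
have wA t : w t *m A t = lam t *: w t.
  by rewrite /w -scalemxAl uA !scalerA mulrC.
have wv t : w t *m v = 1%:M.
  by rewrite /w -scalemxAl mx11_normalize // gt_eqF.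
apply: (is_derive_eq (perron_is_derive n0 A0 irrA dA w0 wA wv v0 Av lam0)).
by rewrite /perron_lam' /w -scalemxAl mxE mulrC.
Qed.

End PerronDerivative.

(** The weights are bounded below by some [c > 0], so the powers of the weighted matrix dominate
    [c ^+ k] times those of [W]. *)
Lemma irreducible_mx_weight (R : realType) n (W E : 'M[R]_n) :
  nneg_mx W -> pos_mx E -> irreducible_mx W ->
  irreducible_mx (\matrix_(i, j) (W i j * E i j)).
Proof.
move=> W0 E0 irrW; set A := \matrix_(i, j) _.
have [c c0 cA] : exists2 c, 0 < c & forall i j, c * W i j <= A i j.
  have [c c0 cE] := @pos_scale_le R ('I_n * 'I_n)%type (fun=> 1)
     (fun ij => E ij.1 ij.2) (fun=> ltr01) (fun=> E0 _ _).
  exists c => // i j; rewrite mxE mulrC ler_wpM2l //.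
  by have := cE (i, j); rewrite mulr1.
have X k i j : c ^+ k * (W ^+ k) i j <= (A ^+ k) i j.
  elim: k i j => [|k IH] i j; first by rewrite !expr0 mul1r.
  rewrite !exprS -!mulmxE !mxE mulr_sumr; apply: ler_sum => l _.
  rewrite mulrACA; apply: ler_pM => //.
  - by rewrite mulr_ge0 // ltW.
  - by apply: mulr_ge0; [exact/exprn_ge0/ltW|exact: nneg_mxX].
move=> i j; have [k k0 Wk] := irrW i j; exists k => //.
by apply: lt_le_trans (X k i j); rewrite mulr_gt0 // exprn_gt0.
Qed.

(** * Cumulants and Poisson equations of an exponentially tilted chain *)

Section TiltedPerron.
Context {R : realType} {n : nat}.
Variables (W G : 'M[R]_n) (lam : R -> R).
Hypothesis n0 : (0 < n)%N.
Hypothesis W0 : nneg_mx W.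
Hypothesis irrW : irreducible_mx W.
Hypothesis W1 : const_mx 1 *m W = const_mx 1 :> 'rV[R]_n.

Let A (t : R) : 'M[R]_n := \matrix_(i, j) (W i j * expR ((t - 1) * G i j)).
Let A' (t : R) : 'M[R]_n := \matrix_(i, j) (W i j * G i j * expR ((t - 1) * G i j)).
Let A'' : 'M[R]_n := \matrix_(i, j) (W i j * G i j ^+ 2).
Let ones : 'rV[R]_n := const_mx 1.

Hypothesis lamP : forall t, is_perron_frobenius (A t) (lam t).

Let A0 t : nneg_mx (A t).
Proof. by move=> i j; rewrite mxE mulr_ge0 ?expR_ge0. Qed.

Let irrA t : irreducible_mx (A t).
Proof.
have E0 : pos_mx (\matrix_(i, j) expR ((t - 1) * G i j)).
  by move=> i j; rewrite mxE expR_gt0.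
have := irreducible_mx_weight W0 E0 irrW; congr irreducible_mx.
by apply/matrixP => i j; rewrite !mxE.
Qed.

Let A1 : A 1 = W.
Proof. by apply/matrixP => i j; rewrite mxE subrr mul0r expR0 mulr1. Qed.

Let A'1 : A' 1 = \matrix_(i, j) (W i j * G i j).
Proof. by apply/matrixP => i j; rewrite !mxE subrr mul0r expR0 mulr1. Qed.

Let dexp (a s : R) : is_derive s 1 (fun t => expR ((t - 1) * a)) (a * expR ((s - 1) * a)).
Proof.
have h : is_derive s 1 (fun t => (t - 1) * a) a.
  apply: (is_derive_eq (is_derive_mulr
    (is_deriveB (is_derive_id s 1) (is_derive_cst (1 : R) s 1)) (is_derive_cst a s 1))).
  by rewrite /= subr0 mul1r mulr0 addr0.
by rewrite mulrC; apply: (is_derive_comp (f := expR) (g := fun t => (t - 1) * a)).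
Qed.

Let dA (s : R) (i j : 'I_n) : is_derive s 1 (fun t => A t i j) (A' s i j).
Proof.
rewrite (_ : (fun t => _) = (fun t => W i j * expR ((t - 1) * G i j))); last first.
  by apply/funext => t; rewrite mxE.
apply: (is_derive_eq (is_derive_mulr (is_derive_cst (W i j) s 1) (dexp (G i j) s))).
by rewrite mul0r add0r mxE mulrA.
Qed.

Let dA' (i j : 'I_n) : is_derive (1 : R) 1 (fun t => A' t i j) (A'' i j).
Proof.
rewrite (_ : (fun t => _) = (fun t => W i j * G i j * expR ((t - 1) * G i j))); last first.
  by apply/funext => t; rewrite mxE.
apply: (is_derive_eq (is_derive_mulr (is_derive_cst (W i j * G i j) (1 : R) 1) (dexp (G i j) 1))).
by rewrite mul0r add0r mxE subrr mul0r expR0 mulr1 expr2 mulrA.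
Qed.

Let lamE t r u v : perron_pair (A t) r u v -> lam t = r.
Proof. by move=> /(perron_frobeniusP n0 (A0 t)); exact: is_perron_frobenius_inj. Qed.

Let lam_gt0 t : 0 < lam t.
Proof.
have [r [u [v [r0 uv]]]] := perron_exists n0 (A0 t) (@irrA t).
by rewrite (lamE uv).
Qed.

Let ones0 : pos_mx ones. Proof. by move=> i j; rewrite mxE. Qed.

Let lam1 : lam 1 = 1.
Proof.
have [r [u [v [r0 uv]]]] := perron_exists n0 (A0 1) (@irrA 1).
rewrite (lamE uv); case: uv => _ v0 _; rewrite A1 => Wv.
have := congr1 (mulmx ones) Wv; rewrite mulmxA W1 -scalemxAr => /matrixP/(_ 0 0).
rewrite [RHS]mxE -[LHS]mul1r => /esym; apply: mulIf.
by rewrite gt_eqF //; exact: pos_mulmx_gt0.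
Qed.

(** The choice is pinned to [ones] at [t = 1], so that the derivatives there are expressed with the
    stationary chain itself. *)
Let pairs t : exists uv : 'rV[R]_n * 'cV[R]_n,
  perron_pair (A t) (lam t) uv.1 uv.2 /\ (t = 1 -> uv.1 = ones).
Proof.
have [r [u [v [r0 uv]]]] := perron_exists n0 (A0 t) (@irrA t).
have e := lamE uv; have [t1|t1] := eqVneq t 1; last first.
  by exists (u, v); split; [rewrite e|move=> t1'; rewrite t1' eqxx in t1].
exists (ones, v); split => //; case: uv => [u0 v0 uA Av]; split => //; last by rewrite e.
by rewrite t1 A1 lam1 scale1r.
Qed.

Lemma tilted_perron : exists D V (h h2 : 'rV[R]_n),
  [/\ is_derive (1 : R) 1 (fun t => ln (lam t)) D,
      is_derive (1 : R) 1 (derive1 (fun t => ln (lam t))) V,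
      0 <= V,
      forall j, \sum_i W i j * (G i j + h 0 i) = D + h 0 j &
      forall j, \sum_i W i j * (G i j - D + h 0 i - h 0 j) ^+ 2
                + \sum_i W i j * h2 0 i = V + h2 0 j].
Proof.
have [f fP] := choice pairs.
(* [pi] is the stationary distribution. Left eigenvectors are normalised against [pi] and right ones
   against [ones], in each case the opposite eigenvector at [t = 1]. *)
pose pi := ((ones *m (f 1).2) 0 0)^-1 *: (f 1).2.
pose u t := (((f t).1 *m pi) 0 0)^-1 *: (f t).1.
pose v t := ((ones *m (f t).2) 0 0)^-1 *: (f t).2.
have fp1 t : pos_mx (f t).1 by have [[]] := fP t.
have fp2 t : pos_mx (f t).2 by have [[]] := fP t.
have ov0 t : 0 < (ones *m (f t).2) 0 0 by exact: pos_mulmx_gt0.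
have v0 t : pos_mx (v t).
  by move=> i j; rewrite mxE mulr_gt0 ?invr_gt0 //; exact: fp2.
have pi0 : pos_mx pi := v0 1.
have up0 t : 0 < ((f t).1 *m pi) 0 0 by exact: pos_mulmx_gt0.
have u0 t : pos_mx (u t).
  by move=> i j; rewrite mxE mulr_gt0 ?invr_gt0 //; exact: fp1.
have uA t : u t *m A t = lam t *: u t.
  by have [[_ _ e _] _] := fP t; rewrite /u -scalemxAl e !scalerA mulrC.
have Av t : A t *m v t = lam t *: v t.
  by have [[_ _ _ e] _] := fP t; rewrite /v -scalemxAr e !scalerA mulrC.
have ov t : ones *m v t = 1%:M by rewrite /v -scalemxAr mx11_normalize // gt_eqF.
have opi : ones *m pi = 1%:M := ov 1.
have upi t : u t *m pi = 1%:M by rewrite /u -scalemxAl mx11_normalize // gt_eqF.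
have u1 : u 1 = ones.
  by rewrite /u (fP 1).2 // opi mxE eqxx invr1 scale1r.
have v1 : v 1 = pi by [].
clearbody pi u v.
have Wpi : W *m pi = pi by rewrite -v1 -A1 Av lam1 scale1r.
have Api : A 1 *m pi = lam 1 *: pi by rewrite -v1.
have lam_ge0 t : 0 <= lam t by exact: ltW.
have [du [ddu dupi duW]] := perron_vec_is_derive n0 (A0 1) (@irrA 1) (dA 1)
  u0 uA upi pi0 Api (lam_ge0 1).
(* Right eigenvectors are differentiated as left eigenvectors of the transposed matrix. *)
have AT0 t : nneg_mx (A t)^T by move=> i j; rewrite mxE; exact: A0.
have dAT i j : is_derive (1 : R) 1 (fun t => (A t)^T i j) ((A' 1)^T i j).
  rewrite mxE (_ : (fun t => _) = (fun t => A t j i)); first exact: dA.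
  by apply/funext => t; rewrite mxE.
have vT0 t : pos_mx (v t)^T by move=> i j; rewrite mxE; exact: v0.
have vAT t : (v t)^T *m (A t)^T = lam t *: (v t)^T.
  by rewrite -trmx_mul Av linearZ.
have voT t : (v t)^T *m ones^T = 1%:M by rewrite -trmx_mul ov trmx1.
have onesT0 : pos_mx ones^T by move=> i j; rewrite !mxE.
have AoT : (A 1)^T *m ones^T = lam 1 *: ones^T.
  by rewrite -trmx_mul A1 W1 lam1 scale1r.
have [dvT [ddv dvo dvW]] := perron_vec_is_derive n0 (AT0 1)
  (irreducible_mx_tr (@irrA 1)) dAT vT0 vAT voT onesT0 AoT (lam_ge0 1).
pose dv := dvT^T.
pose D := (ones *m (A' 1 *m pi)) 0 0.
pose N t := \sum_i \sum_j u t 0 i * (A' t i j * v t j 0).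
pose Z t := \sum_i u t 0 i * v t i 0.
have NE t : (u t *m (A' t *m v t)) 0 0 = N t.
  by rewrite mxE; apply: eq_bigr => i _; rewrite [(A' t *m _) i 0]mxE mulr_sumr.
have ZE t : (u t *m v t) 0 0 = Z t by rewrite mxE.
have Z0 t : 0 < Z t by rewrite -ZE; exact: pos_mulmx_gt0.
have dlam (t : R) : is_derive t 1 lam (N t / Z t).
  by rewrite -NE -ZE; exact: (perron_is_derive_gen n0 (A0 t) (@irrA t) (dA t)).
have dln (t : R) : is_derive t 1 (fun t => ln (lam t)) (N t / Z t / lam t).
  rewrite [_ / lam t]mulrC.
  exact: is_derive_comp (is_derive1_ln (lam_gt0 t)) (dlam t).
have dlnE : derive1 (fun t => ln (lam t)) = (fun t => N t / Z t / lam t).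
  by apply/funext => t; exact: is_derive_derive1.
have Z1 : Z 1 = 1 by rewrite -ZE u1 v1 opi mxE eqxx.
have N1 : N 1 = D by rewrite -NE u1 v1.
pose S := (ones *m (A'' *m pi)) 0 0.
pose K := (du *m (A' 1 *m pi)) 0 0.
have ddv' i : is_derive (1 : R) 1 (fun t => v t i 0) (dv i 0).
  rewrite mxE; have := ddv i; congr (is_derive _ _ _ _).
  by apply/funext => t; rewrite mxE.
have odv : ones *m dv = 0 by rewrite -[ones]trmxK -trmx_mul dvo trmx0.
have Wdv : W *m dv + A' 1 *m pi = D *: pi + dv.
  have /= := congr1 trmx dvW; rewrite !linearD /= !linearZ /= !trmx_mul !trmxK A1 lam1 scale1r.
  rewrite v1 => ->; congr (_ *: _ + _).
  by rewrite /perron_lam' /= -!trmx_mul [LHS]mxE v1 -mulmxA.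
have duW' : du *m W + ones *m A' 1 = D *: ones + du.
  by have := duW; rewrite /perron_lam' A1 lam1 scale1r u1.
(* Pair the equation for [dv] with [du] and the equation for [du] with [dv]: the terms
   [du *m W *m dv] and [du *m dv] cancel, so the two cross terms of the second derivative
   coincide. *)
have KE : (ones *m (A' 1 *m dv)) 0 0 = K.
  have e1 := congr1 (mulmx du) Wdv.
  have e2 := congr1 (mulmx^~ dv) duW'.
  have e3 : du *m (A' 1 *m pi) = ones *m (A' 1 *m dv).
    move: e1 e2; rewrite !mulmxDr !mulmxDl -scalemxAr dupi -scalemxAl odv !scaler0 !add0r.
    by rewrite !mulmxA => <- /addrI.
  by rewrite /K e3.
have dZ : is_derive (1 : R) 1 Z 0.
  apply: (is_derive_eq (is_derive_finsum (fun i => is_derive_mulr (ddu i) (ddv' i)))).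
  rewrite big_split /= u1 v1.
  have /matrixP/(_ 0 0) := dupi; rewrite !mxE => ->.
  have /matrixP/(_ 0 0) := odv; rewrite !mxE => ->.
  by rewrite addr0.
have dN : is_derive (1 : R) 1 N (K + S + K).
  apply: (is_derive_eq (is_derive_finsum (fun i => is_derive_finsum (fun j =>
    is_derive_mulr (ddu i) (is_derive_mulr (dA' i j) (ddv' j)))))).
  rewrite u1 v1 -addrA -[X in _ = _ + (_ + X)]KE /K /S !mxE -!big_split /=.
  apply: eq_bigr => i _; rewrite [(A' 1 *m pi) i 0]mxE [(A'' *m pi) i 0]mxE.
  rewrite [(A' 1 *m dv) i 0]mxE !mulr_sumr -!big_split /=.
  by apply: eq_bigr => j _; rewrite mulrDr.
have ddln : is_derive (1 : R) 1 (derive1 (fun t => ln (lam t))) (2 * K + S - D ^+ 2).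
  rewrite dlnE; apply: (is_derive_eq (is_derive_divr _ (is_derive_divr _ dN dZ) (dlam 1))).
  - by rewrite lam1 oner_neq0.
  - by rewrite Z1 oner_neq0.
  - by rewrite Z1 N1 lam1 !expr1n !divr1 mulr0 subr0 !mulr1; ring.
have poisson j : \sum_i W i j * (G i j + du 0 i) = D + du 0 j.
  under eq_bigr do rewrite mulrDr.
  rewrite big_split /=; have /matrixP/(_ 0 j) := duW'; rewrite A'1 !mxE mulr1 => <-.
  rewrite addrC; congr (_ + _); apply: eq_bigr => i _; first exact: mulrC.
  by rewrite !mxE mul1r.
pose V := 2 * K + S - D ^+ 2.
pose a i := du 0 i.
pose p i := pi i 0.
pose s2 j := \sum_i W i j * (G i j - D + a i - a j) ^+ 2.
have Wsum j : \sum_i W i j = 1.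
  have /matrixP/(_ 0 j) := W1; rewrite !mxE => e; rewrite -[RHS]e.
  by apply: eq_bigr => i _; rewrite mxE mul1r.
have Wp i : \sum_j W i j * p j = p i.
  by have /matrixP/(_ i 0) := Wpi; rewrite mxE.
have psum : \sum_j p j = 1.
  have /matrixP/(_ 0 0) := opi; rewrite !mxE eqxx mulr1n => e; rewrite -[RHS]e.
  by apply: eq_bigr => i _; rewrite mxE mul1r.
have ap : \sum_j a j * p j = 0.
  by have /matrixP/(_ 0 0) := dupi; rewrite !mxE.
have s2E j : s2 j = \sum_i W i j * G i j ^+ 2 + 2 * (\sum_i W i j * G i j * a i)
    + \sum_i W i j * a i ^+ 2 - D ^+ 2 - 2 * D * a j - a j ^+ 2.
  rewrite /s2 (eq_bigr (fun i => W i j * G i j ^+ 2 + (2 * (W i j * G i j * a i) +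
    (W i j * a i ^+ 2 + (- 2 * (D + a j) * (W i j * (G i j + a i))
     + (D + a j) ^+ 2 * W i j))))); last by move=> i _; ring.
  by rewrite !big_split -!mulr_sumr poisson Wsum /a /=; ring.
(* In the expanded square, invariance of [pi] cancels the terms in [a ^+ 2] and the zero mean of [a]
   kills the linear one; [S + 2 * K - D ^+ 2] remains. *)
have s2V : \sum_j s2 j * p j = V.
  have e1 : \sum_j (\sum_i W i j * G i j ^+ 2) * p j = S.
    rewrite /S mxE; under eq_bigr do rewrite mulr_suml.
    rewrite exchange_big /=; apply: eq_bigr => i _; rewrite !mxE mul1r.
    by apply: eq_bigr => j _; rewrite mxE.
  have e2 : \sum_j (\sum_i W i j * G i j * a i) * p j = K.
    rewrite /K mxE; under eq_bigr do rewrite mulr_suml.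
    rewrite exchange_big /=; apply: eq_bigr => i _; rewrite A'1 mxE mulr_sumr.
    by apply: eq_bigr => j _; rewrite mxE /a /p; ring.
  have e3 : \sum_j (\sum_i W i j * a i ^+ 2) * p j = \sum_i a i ^+ 2 * p i.
    under eq_bigr do rewrite mulr_suml.
    rewrite exchange_big /=; apply: eq_bigr => i _; rewrite -Wp mulr_sumr.
    by apply: eq_bigr => j _; ring.
  rewrite (eq_bigr (fun j => (\sum_i W i j * G i j ^+ 2) * p j +
    (2 * ((\sum_i W i j * G i j * a i) * p j) + ((\sum_i W i j * a i ^+ 2) * p j
     + (- D ^+ 2 * p j + (- (2 * D) * (a j * p j) + -1 * (a j ^+ 2 * p j)))))));
    last by move=> j _; rewrite s2E; ring.
  rewrite !big_split -!mulr_sumr /= e1 e2 e3 psum ap /V; ring.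
have V0 : 0 <= V.
  rewrite -s2V; apply: sumr_ge0 => j _; apply: mulr_ge0; last exact/ltW/pi0.
  by apply: sumr_ge0 => i _; rewrite mulr_ge0 // sqr_ge0.
(* Second Poisson equation: [V - s2] has mean zero under [pi], so its preimage [h2] under [M] also
   pairs to 0 with [pi] and the border term disappears. *)
pose M := W - 1%:M + pi *m ones.
have Mu : M \in unitmx.
  have pp : perron_pair (A 1) (lam 1) ones pi by split => //; rewrite A1 lam1 W1 scale1r.
  by have := perron_border_unit n0 (A0 1) (@irrA 1) (lam_ge0 1) pp; rewrite A1 lam1.
pose f2 : 'rV[R]_n := \row_j (V - s2 j).
pose h2 := f2 *m invmx M.
have h2M : h2 *m M = f2 by rewrite mulmxKV.
have f2pi : f2 *m pi = 0.
  apply/matrixP => i j; rewrite !ord1 !mxE.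
  rewrite (eq_bigr (fun j => V * p j - s2 j * p j)); last first.
    by move=> k _; rewrite mxE mulrBl.
  by rewrite sumrB -mulr_sumr psum s2V mulr1 subrr.
have h2pi : h2 *m pi = 0.
  have Mpi : M *m pi = pi.
    by rewrite mulmxDl mulmxBl Wpi mul1mx subrr add0r -mulmxA opi mulmx1.
  by rewrite -Mpi mulmxA h2M.
exists D, V, du, h2; split => //.
  by have := dln 1; rewrite N1 Z1 lam1 !divr1.
move=> j; have /matrixP/(_ 0 j) := h2M.
rewrite mulmxDr mulmxA h2pi mul0mx addr0 mulmxBr mulmx1 !mxE -/(s2 j) => e.
rewrite (eq_bigr (fun i => h2 0 i * W i j)); last by move=> i _; exact: mulrC.
by move/eqP: e; rewrite subr_eq => /eqP ->; rewrite -/(s2 j); ring.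
Qed.

End TiltedPerron.

(** * Gaussian distribution function and heat flow *)

Section GaussianCdf.
Context {R : realType}.
Implicit Types x y e : R.

Definition gauss_pdf x : R := expR (- x ^+ 2 / 2) / Num.sqrt (2 * pi).

Lemma gauss_pdfE : gauss_pdf = normal_pdf 0 1.
Proof.
apply/funext => x; rewrite normal_pdfE ?oner_neq0 // /gauss_pdf /normal_peak /normal_fun.
by rewrite subr0 expr1n mul1r mulrC -[pi *+ 2]mulr_natl.
Qed.

Lemma gauss_pdf_gt0 x : 0 < gauss_pdf x.
Proof. by rewrite divr_gt0 ?expR_gt0 // sqrtr_gt0 mulr_gt0 ?pi_gt0. Qed.

Lemma integrable_gauss_pdf (D : set R) : measurable D ->
  lebesgue_measure.-integrable D (EFin \o gauss_pdf).
Proof.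
move=> mD; apply: (@integrableS _ _ _ _ setT) => //.
by rewrite gauss_pdfE; exact: (integrable_normal_pdf 0 1).
Qed.

Lemma Phi_normal_prob y : (Phi y)%:E = normal_prob 0 1 `]-oo, y]%classic.
Proof.
rewrite /normal_prob /Phi /Rintegral fineK.
  by apply: eq_integral => x _; rewrite -gauss_pdfE.
by apply: integrable_fin_num => //; exact: integrable_gauss_pdf.
Qed.

Lemma Phi_is_derive y : is_derive y 1 (@Phi R) (gauss_pdf y).
Proof.
have [] := @continuous_FTC1 R gauss_pdf -oo%O y (y + 1).
- by rewrite ltrDl.
- exact: integrable_gauss_pdf.
- exact: ltNyr.
- by rewrite gauss_pdfE; apply: continuous_normal_pdf; exact: oner_neq0.
by move=> dP; rewrite derive1E => <-; exact: derivableP.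
Qed.

Lemma Phi_lt x y : x < y -> Phi x < Phi y.
Proof.
move=> xy; have [|c _ e] := @MVT R (@Phi R) gauss_pdf x y xy (fun t _ => Phi_is_derive t).
  apply: derivable_within_continuous => t _.
  exact: (@ex_derive _ _ _ _ _ _ _ (Phi_is_derive t)).
by rewrite -subr_gt0 e mulr_gt0 ?gauss_pdf_gt0 ?subr_gt0.
Qed.

Lemma Phi_le x y : x <= y -> Phi x <= Phi y.
Proof. by rewrite le_eqVlt => /predU1P[->//|/Phi_lt/ltW]. Qed.

Lemma Phi_ge0 y : 0 <= Phi y.
Proof. by rewrite -lee_fin Phi_normal_prob. Qed.

Lemma Phi_le1 y : Phi y <= 1.
Proof. by rewrite -lee_fin Phi_normal_prob; exact: probability_le1. Qed.

(** [Phi] is the distribution function of the identity, viewed as a random variable under the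
    standard normal law. *)
Lemma Phi_cvg : Phi y @[y --> +oo] --> (1 : R) /\ Phi y @[y --> -oo] --> (0 : R).
Proof.
have mid : @measurable_fun _ _ (measurableTypeR R) R [set: R] id by exact: measurable_id.
pose X : {RV (normal_prob (0 : R) 1) >-> R} :=
  @mfun_Sub _ default_measure_display (measurableTypeR R) R id (mem_set mid).
have XE : cdf X = EFin \o (@Phi R).
  by apply/funext => y; rewrite /= Phi_normal_prob.
split.
  by have := cvg_cdfy1 X; rewrite XE => /fine_cvgP[].
by have := cvg_cdfNy0 X; rewrite XE => /fine_cvgP[].
Qed.

Lemma Phi_tails e : 0 < e -> exists2 K : R, 0 < K & 1 - e < Phi K /\ Phi (- K) < e.
Proof.
move=> e0; have [c1 c2] := Phi_cvg.
have /(_ _ e e0) [K1 [K1r h1]] := (cvgrPdist_lt _ _).1 c1.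
have /(_ _ e e0) [K2 [K2r h2]] := (cvgrPdist_lt _ _).1 c2.
exists (`|K1| + `|K2| + 1); first by rewrite ltr_pwDr // addr_ge0.
split.
  have := h1 (`|K1| + `|K2| + 1); rewrite [`|1 - _|]ger0_norm ?subr_ge0 ?Phi_le1 //.
  have := ler_norm K1; have := normr_ge0 K2 => a b h.
  by have := h ltac:(lra); lra.
have := h2 (- (`|K1| + `|K2| + 1)); rewrite sub0r normrN [`|Phi _|]ger0_norm ?Phi_ge0 //; apply.
by have := ler_norm (- K2); rewrite normrN; have := normr_ge0 K1; lra.
Qed.

(** The default value 0 of [Phi_inv] is excluded because the intermediate value theorem, between two
    tails, provides a preimage. *)
Lemma Phi_invK e : 0 < e < 1 -> Phi (Phi_inv e) = e.
Proof.
move=> /andP[e0 e1]; suff [y ye] : exists y, Phi y = e.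
  by rewrite /Phi_inv; case: xgetP => [z _ //|/(_ y)].
have [|K K0 [hK hKN]] := @Phi_tails (Num.min e (1 - e)).
  by rewrite lt_min e0 subr_gt0.
have KK : - K <= K by lra.
have [||c _ ce] := @IVT R (@Phi R) (- K) K e KK.
- apply: derivable_within_continuous => t _.
  exact: (@ex_derive _ _ _ _ _ _ _ (Phi_is_derive t)).
- have m1 : Num.min e (1 - e) <= e by rewrite ge_min lexx.
  have m2 : Num.min e (1 - e) <= 1 - e by rewrite ge_min lexx orbT.
  by rewrite ge_min le_max; apply/andP; split; apply/orP; [left|right]; lra.
by exists c.
Qed.

End GaussianCdf.

Section Taylor.
Context {R : realType}.
Implicit Types (f df : R -> R) (x y z d C : R).

Lemma MVT_between f df x y :
  (forall t, Num.min x y <= t <= Num.max x y -> is_derive t 1 f (df t)) ->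
  exists2 c, Num.min x y <= c <= Num.max x y & f y - f x = df c * (y - x).
Proof.
wlog xy : x y / x <= y => [hwlog|].
  case/orP: (le_total x y) => [|yx h]; first exact: hwlog.
  have [|c cxy e] := hwlog y x yx; first by rewrite minC maxC.
  exists c; first by rewrite minC maxC.
  by rewrite -[LHS]opprB e -mulrN opprB.
rewrite (min_idPl xy) (max_idPr xy) => h.
have [||c cxy e] := @MVT_segment R f df x y xy.
- by move=> t; rewrite in_itv /= => /andP[/ltW xt /ltW ty]; apply: h; rewrite xt.
- apply: derivable_within_continuous => t; rewrite in_itv /= => xty.
  by have dt := h t xty; exact: ex_derive.
- by exists c => //; move: cxy; rewrite in_itv.
Qed.

Lemma between_dist x y t : Num.min x y <= t <= Num.max x y -> `|t - x| <= `|y - x|.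
Proof.
by rewrite ge_min le_max => /andP[/orP[a|a] /orP[b|b]];
  rewrite ler_norml; case: (ler0P (y - x)) => c; apply/andP; split; lra.
Qed.

Lemma taylor1_le f df x y C :
  (forall t, Num.min x y <= t <= Num.max x y -> is_derive t 1 f (df t)) ->
  (forall t, Num.min x y <= t <= Num.max x y -> `|df t| <= C) ->
  `|f y - f x| <= C * `|y - x|.
Proof.
move=> fd fC; have [c cxy ->] := MVT_between fd.
by rewrite normrM ler_wpM2r // fC.
Qed.

(** The mean value bound is applied first to the remainder of [f1], then to that of [f]; a Lipschitz
    [f2] suffices and the constant is not optimised. *)
Lemma taylor2_le f f1 f2 z d C : 0 <= C ->
  (forall t : R, is_derive t 1 f (f1 t)) -> (forall t : R, is_derive t 1 f1 (f2 t)) ->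
  (forall x y, `|f2 y - f2 x| <= C * `|y - x|) ->
  `|f (z + d) - f z - d * f1 z - d ^+ 2 / 2 * f2 z| <= C * `|d| ^+ 3.
Proof.
move=> C0 df df1 lip.
pose r t := f t - (t - z) * f1 z - (t - z) ^+ 2 / 2 * f2 z.
pose r1 t := f1 t - f1 z - (t - z) * f2 z.
have dr (t : R) : is_derive t 1 r (r1 t).
  rewrite /r /r1.
  have dz : is_derive t 1 (fun t : R => t - z) 1.
    apply: (is_derive_eq (is_deriveB (is_derive_id t 1) (is_derive_cst z t 1))).
    by rewrite subr0.
  have dq : is_derive t 1 (fun t : R => (t - z) ^+ 2 / 2) (t - z).
    have -> : (fun t : R => (t - z) ^+ 2 / 2) = (fun t => (t - z) * ((t - z) * 2^-1)).
      by apply/funext => a; rewrite expr2 mulrA.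
    have h := is_derive_mulr dz (is_derive_mulr dz (is_derive_cst (2^-1 : R) t 1)).
    by apply: (is_derive_eq h); rewrite /=; field.
  have := is_deriveB (is_deriveB (df t) (is_derive_mulr dz (is_derive_cst (f1 z) t 1)))
    (is_derive_mulr dq (is_derive_cst (f2 z) t 1)).
  by move=> h; apply: (is_derive_eq h); rewrite /=; ring.
have r1C t : Num.min z (z + d) <= t <= Num.max z (z + d) -> `|r1 t| <= C * `|d| ^+ 2.
  move=> /between_dist; rewrite addrAC subrr add0r => td.
  pose k s := f1 s - (s - z) * f2 z.
  have dk (s : R) : is_derive s 1 k (f2 s - f2 z).
    have dz : is_derive s 1 (fun t : R => t - z) 1.
      apply: (is_derive_eq (is_deriveB (is_derive_id s 1) (is_derive_cst z s 1))).
      by rewrite subr0.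
    have := is_deriveB (df1 s) (is_derive_mulr dz (is_derive_cst (f2 z) s 1)).
    by move=> h; apply: (is_derive_eq h); rewrite /=; ring.
  have -> : r1 t = k t - k z by rewrite /r1 /k subrr mul0r subr0; ring.
  apply: (@le_trans _ _ (C * `|d| * `|t - z|)); last first.
    by rewrite expr2 mulrA ler_wpM2l ?mulr_ge0.
  apply: (taylor1_le (fun s _ => dk s)) => s /between_dist sz.
  by apply: (le_trans (lip _ _)); rewrite ler_wpM2l // (le_trans sz).
have zd : z + d - z = d by rewrite addrAC subrr add0r.
have := taylor1_le (fun t _ => dr t) r1C; rewrite /r zd subrr -[leRHS]mulrA -exprSr.
by rewrite mul0r expr0n /= !mul0r !subr0; congr (`|_| <= _); ring.
Qed.

End Taylor.

Section HeatKernel.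
Context {R : realType}.
Implicit Types s z w : R.

Lemma gauss_pdf_is_derive w : is_derive w 1 (@gauss_pdf R) (- w * gauss_pdf w).
Proof.
rewrite /gauss_pdf.
have h1 : is_derive w 1 (fun t : R => - t ^+ 2 / 2) (- w).
  have -> : (fun t : R => - t ^+ 2 / 2) = (fun t => t * (t * (- 2^-1))).
    by apply/funext => t; rewrite expr2; ring.
  have h := is_derive_mulr (is_derive_id w 1)
    (is_derive_mulr (is_derive_id w 1) (is_derive_cst (- 2^-1 : R) w 1)).
  by apply: (is_derive_eq h); rewrite /=; field.
have h2 := is_derive_comp (f := expR) (is_derive_expR _) h1.
have h := is_derive_mulr h2 (is_derive_cst ((Num.sqrt (2 * pi))^-1 : R) w 1).
by apply: (is_derive_eq h); rewrite /=; ring.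
Qed.

(** The 8 comes from [exp u >= 1 + u^2 / 2] at [u = w^2 / 2], that is, [1 + w^4 / 8]. *)
Definition gauss_bound : R := 8 / Num.sqrt (2 * pi).

Lemma gauss_bound_ge0 : 0 <= gauss_bound.
Proof. by rewrite divr_ge0 // sqrtr_ge0. Qed.

Lemma gauss_pdf_moment_le w : (1 + w ^+ 4) * gauss_pdf w <= gauss_bound.
Proof.
rewrite /gauss_pdf /gauss_bound mulrA ler_wpM2r ?invr_ge0 ?sqrtr_ge0 //.
rewrite mulNr expRN ler_pdivrMr ?expR_gt0 //.
have w2 : 0 <= w ^+ 2 / 2 by rewrite divr_ge0 // sqr_ge0.
have := expR_ge1Dxn 1 w2; rewrite (_ : 2`!%:R = 2 :> R) //.
have -> : w ^+ 4 = (w ^+ 2) ^+ 2 by rewrite -exprM.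
by move: (w ^+ 2) => x; move: (expR _) => E; lra.
Qed.

Lemma mul_gauss_pdf_le w p k : `|p| <= k * (1 + w ^+ 4) -> 0 <= k ->
  `|p * gauss_pdf w| <= k * gauss_bound.
Proof.
move=> pk k0; have g0 := gauss_pdf_gt0 w.
rewrite normrM (gtr0_norm g0); apply: (@le_trans _ _ (k * (1 + w ^+ 4) * gauss_pdf w)).
  by rewrite ler_wpM2r // ltW.
by rewrite -mulrA ler_wpM2l // gauss_pdf_moment_le.
Qed.

Let q s : R := (Num.sqrt s)^-1.

Let dq s : 0 < s -> is_derive s 1 q (- (q s ^+ 3 / 2)).
Proof.
move=> s0; have s1 : Num.sqrt s != 0 by rewrite gt_eqF // sqrtr_gt0.
have h := is_deriveV (f := Num.sqrt) s1 (is_derive1_sqrt s0).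
by apply: (is_derive_eq h); rewrite /q [_ *: _]mulNr; field.
Qed.

Variables (y dlt : R).
Hypothesis dlt0 : 0 < dlt.

Let w s z := (y - z) * q s.

Let dws s z : 0 < s -> is_derive s 1 (w^~ z) (- (w s z * q s ^+ 2 / 2)).
Proof.
move=> s0; have h := is_derive_mulr (is_derive_cst (y - z) s 1) (dq s0).
by apply: (is_derive_eq h); rewrite /w /=; ring.
Qed.

Let dwz s z : is_derive z 1 (w s) (- q s).
Proof.
have h := is_derive_mulr (is_deriveB (is_derive_cst y z 1) (is_derive_id z 1))
  (is_derive_cst (q s) z 1).
by apply: (is_derive_eq h); rewrite /=; ring.
Qed.

(** The probability that [z] plus a centred Gaussian of variance [s] is at most [y]: a smoothed
    indicator of [z <= y]. Below, [heat1] to [heat3] are its successive derivatives in [z], and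
    [heat4] is the time derivative of [heat2]. *)
Definition heat s z : R := Phi ((y - z) / Num.sqrt s).
Let heat1 s z := - gauss_pdf (w s z) * q s.
Let heat2 s z := - w s z * gauss_pdf (w s z) * q s ^+ 2.
Let heat3 s z := - (w s z ^+ 2 - 1) * gauss_pdf (w s z) * q s ^+ 3.
Let heat4 s z := w s z * (3 - w s z ^+ 2) / 2 * gauss_pdf (w s z) * q s ^+ 4.

Let dheat_z s z : is_derive z 1 (heat s) (heat1 s z).
Proof.
have h := is_derive_comp (f := @Phi R) (Phi_is_derive _) (dwz s z).
by apply: (is_derive_eq h); rewrite /heat1; ring.
Qed.

Let dgw_z s z : is_derive z 1 (fun t => gauss_pdf (w s t)) (w s z * gauss_pdf (w s z) * q s).
Proof.
have h := is_derive_comp (f := @gauss_pdf R) (gauss_pdf_is_derive _) (dwz s z).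
by apply: (is_derive_eq h); ring.
Qed.

Let dheat1_z s z : is_derive z 1 (heat1 s) (heat2 s z).
Proof.
have h := is_derive_mulr (is_derive_mulr (is_derive_cst (-1 : R) z 1) (dgw_z s z))
  (is_derive_cst (q s) z 1).
have -> : heat1 s = (fun t => cst (-1) t * gauss_pdf (w s t) * cst (q s) t).
  by apply/funext => t; rewrite /heat1 /= mulN1r.
by apply: (is_derive_eq h); rewrite /heat2 /=; ring.
Qed.

Let dheat2_z s z : is_derive z 1 (heat2 s) (heat3 s z).
Proof.
have h := is_derive_mulr (is_derive_mulr (is_derive_mulr (is_derive_cst (-1 : R) z 1) (dwz s z))
   (dgw_z s z)) (is_derive_cst (q s ^+ 2) z 1).
have -> : heat2 s = (fun t => cst (-1) t * w s t * gauss_pdf (w s t) * cst (q s ^+ 2) t).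
  by apply/funext => t; rewrite /heat2 /= mulN1r.
by apply: (is_derive_eq h); rewrite /heat3 /=; ring.
Qed.

Let dheat_s s z : 0 < s -> is_derive s 1 (heat^~ z) (heat2 s z / 2).
Proof.
move=> s0; have h := is_derive_comp (f := @Phi R) (Phi_is_derive _) (dws z s0).
by apply: (is_derive_eq h); rewrite /heat2; ring.
Qed.

Let dheat2_s s z : 0 < s -> is_derive s 1 (heat2^~ z) (heat4 s z).
Proof.
move=> s0.
have h1 := is_derive_comp (f := @gauss_pdf R) (gauss_pdf_is_derive _) (dws z s0).
have h := is_derive_mulr (is_derive_mulr (is_derive_mulr (is_derive_cst (-1 : R) s 1) (dws z s0))
   h1) (is_derive_mulr (dq s0) (dq s0)).
have -> : heat2^~ z = (fun t => cst (-1) t * w t z * gauss_pdf (w t z) * (q t * q t)).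
  by apply/funext => t; rewrite /heat2 /= mulN1r expr2.
by apply: (is_derive_eq h); rewrite /heat4 /=; field.
Qed.

Let C := 2 * gauss_bound * (1 + q dlt) ^+ 4.

Let q_ge0 s : 0 <= q s. Proof. by rewrite invr_ge0 sqrtr_ge0. Qed.

Let C_ge0 : 0 <= C.
Proof.
by apply: mulr_ge0; [rewrite mulr_ge0 ?gauss_bound_ge0|rewrite exprn_ge0 ?addr_ge0 ?q_ge0].
Qed.

Let qX_le s (k : nat) : dlt <= s -> (k <= 4)%N -> q s ^+ k <= (1 + q dlt) ^+ 4.
Proof.
move=> ds k4; apply: (@le_trans _ _ ((1 + q dlt) ^+ k)).
  apply: lerXn2r; rewrite ?nnegrE ?q_ge0 ?addr_ge0 ?q_ge0 //.
  apply: (@le_trans _ _ (q dlt)); last by rewrite lerDr.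
  rewrite /q lef_pV2 ?posrE ?sqrtr_gt0 ?(lt_le_trans dlt0) //.
  exact: ler_wsqrtr.
by apply: ler_weXn2l => //; rewrite lerDl q_ge0.
Qed.

Let pdf_bound s (x p : R) k : dlt <= s -> (k <= 4)%N -> `|p| <= 2 * (1 + x ^+ 4) ->
  `|p * gauss_pdf x * q s ^+ k| <= C.
Proof.
move=> ds k4 pk; rewrite normrM; apply: ler_pM => //.
  by apply: mul_gauss_pdf_le.
by rewrite ger0_norm ?exprn_ge0 ?q_ge0 //; exact: qX_le.
Qed.

Let x4E (x : R) : x ^+ 4 = (x ^+ 2) ^+ 2. Proof. by rewrite -exprM. Qed.

Let heat1_le s z : dlt <= s -> `|heat1 s z| <= C.
Proof.
move=> ds; rewrite /heat1 -mulN1r -[q s]expr1; apply: pdf_bound => //.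
by rewrite normrN normr1 x4E; have := sqr_ge0 (w s z ^+ 2); lra.
Qed.

Let heat2_le s z : dlt <= s -> `|heat2 s z| <= C.
Proof.
move=> ds; apply: pdf_bound => //; rewrite normrN x4E.
rewrite -[w s z ^+ 2]real_normK ?num_real //; move: `|_| => x.
by have := sqr_ge0 (x - 1); have := sqr_ge0 (x ^+ 2 - 1); nra.
Qed.

Let heat3_le s z : dlt <= s -> `|heat3 s z| <= C.
Proof.
move=> ds; apply: pdf_bound => //; rewrite normrN x4E ler_norml.
by have := sqr_ge0 (w s z); move: (w s z ^+ 2) => x x0; apply/andP; split; nra.
Qed.

Let heat4_le s z : dlt <= s -> `|heat4 s z| <= C.
Proof.
move=> ds; apply: pdf_bound => //; rewrite x4E ler_norml.
move: (w s z) => x; have := sqr_ge0 (x ^+ 2); have := sqr_ge0 (x - 1).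
have := sqr_ge0 (x + 1); have := sqr_ge0 (x ^+ 2 - 1); have := sqr_ge0 (x * (x - 1)).
by have := sqr_ge0 (x * (x + 1)) => *; apply/andP; split; nra.
Qed.

Lemma heat_expansion : exists p1 p2 : R -> R -> R, exists2 C, 0 <= C &
  forall s z, dlt <= s ->
  [/\ forall d, `|heat s (z + d) - heat s z - d * p1 s z - d ^+ 2 / 2 * p2 s z|
        <= C * `|d| ^+ 3,
      forall t, 0 <= t -> `|heat (s + t) z - heat s z - t / 2 * p2 s z| <= C * t ^+ 2,
      (forall d, `|p2 s (z + d) - p2 s z| <= C * `|d|) /\
      (forall t, 0 <= t -> `|p2 (s + t) z - p2 s z| <= C * t),
      `|p2 s z| <= C &
      forall d, `|heat s (z + d) - heat s z| <= C * `|d|].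
Proof.
exists heat1, heat2; exists C => // s z ds.
have s0 : 0 < s := lt_le_trans dlt0 ds.
have lip2 a b : `|heat2 s b - heat2 s a| <= C * `|b - a|.
  by apply: (taylor1_le (fun t _ => dheat2_z s t)) => t _; exact: heat3_le.
have mt t r : 0 <= t -> Num.min s (s + t) <= r <= Num.max s (s + t) -> s <= r.
  by move=> t0; have st : s <= s + t; [rewrite lerDl|rewrite (min_idPl st) => /andP[]].
have lips t : 0 <= t -> `|heat2 (s + t) z - heat2 s z| <= C * t.
  move=> t0; suff : `|heat2 (s + t) z - heat2 s z| <= C * `|s + t - s|.
    by rewrite [s + t - s]addrAC subrr add0r [`|t|]ger0_norm.
  apply: (taylor1_le (f := heat2^~ z) (df := heat4^~ z)) => x /(mt _ _ t0) sx.
    by apply: dheat2_s; exact: lt_le_trans s0 sx.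
  by apply: heat4_le; exact: le_trans ds sx.
split.
- by move=> d; apply: taylor2_le.
- move=> t t0.
  have [|c cc e] := @MVT_between R (heat^~ z) (fun x => heat2 x z / 2) s (s + t).
    by move=> x /(mt _ _ t0) sx; apply: dheat_s; exact: lt_le_trans s0 sx.
  rewrite e [s + t]addrC addrK.
  have sc := mt _ _ t0 cc.
  have ct : c - s <= t.
    by have := between_dist cc; rewrite [s + t]addrC addrK !ger0_norm // subr_ge0.
  have -> : heat2 c z / 2 * t - t / 2 * heat2 s z = (heat2 c z - heat2 s z) * (t / 2) by field.
  have cs0 : 0 <= c - s by rewrite subr_ge0.
  have := lips _ cs0; rewrite [s + _]addrC subrK => h.
  rewrite normrM [`|t / 2|]ger0_norm ?divr_ge0 //.
  apply: (@le_trans _ _ (C * t * t)); last by rewrite expr2 mulrA.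
  apply: ler_pM => //; rewrite ?divr_ge0 //; last by rewrite ler_pdivrMr //; lra.
  by apply: (le_trans h); rewrite ler_wpM2l.
- split=> [d|t t0]; last exact: lips.
  by have := lip2 z (z + d); rewrite [z + d - z]addrAC subrr add0r.
- exact: heat2_le.
- move=> d; have := @taylor1_le R (heat s) (heat1 s) z (z + d) C (fun t _ => dheat_z s t).
  by rewrite [z + d - z]addrAC subrr add0r; apply => t _; exact: heat1_le.
Qed.

End HeatKernel.

(** * Central limit theorem for additive functionals *)

Section ChainExpectation.
Context {R : realType} {X : finType}.
Variables (W g : X -> X -> R) (P l0 : X -> R).
Implicit Types F G : X -> R -> R.

(* Expectation of [F X_k L_k] where [X_0] has law [P], [L_0 = l0 X_0] and
   [L_{k+1} = L_k + g X_{k+1} X_k]. *)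
Fixpoint chain_exp (k : nat) F : R :=
  if k is k'.+1 then
    chain_exp k' (fun xb l => \sum_x W x xb * F x (l + g x xb))
  else \sum_x P x * F x (l0 x).

Hypothesis hW : is_transition_matrix W.
Hypothesis hP : is_distribution P.

Lemma chain_exp_le k F G : (forall x l, F x l <= G x l) ->
  chain_exp k F <= chain_exp k G.
Proof.
elim: k F G => [|k IH] F G FG /=.
  by apply: ler_sum => x _; rewrite ler_wpM2l //; exact: hP.1.
apply: IH => xb l; apply: ler_sum => x _; rewrite ler_wpM2l //; exact: hW.1.
Qed.

Lemma chain_expD k F G :
  chain_exp k (fun x l => F x l + G x l) = chain_exp k F + chain_exp k G.
Proof.
elim: k F G => [|k IH] F G /=.
  by rewrite -big_split /=; apply: eq_bigr => x _; rewrite mulrDr.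
rewrite -IH; congr chain_exp; apply/funext => xb; apply/funext => l.
by rewrite -big_split /=; apply: eq_bigr => x _; rewrite mulrDr.
Qed.

Lemma chain_exp_cst k c : chain_exp k (fun _ _ => c) = c.
Proof.
elim: k => [|k IH] /=; first by rewrite -mulr_suml hP.2 mul1r.
rewrite -[RHS]IH; congr chain_exp; apply/funext => xb; apply/funext => l.
by rewrite -mulr_suml hW.2 mul1r.
Qed.

Lemma chain_exp_dist k F G c : (forall x l, `|F x l - G x l| <= c) ->
  `|chain_exp k F - chain_exp k G| <= c.
Proof.
move=> FG; rewrite ler_norml lerBlDr lerBrDr.
have e H K : (forall x l, H x l - K x l <= c) -> chain_exp k H <= c + chain_exp k K.
  move=> HK; rewrite -[X in X + _](chain_exp_cst k c) -chain_expD.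
  by apply: chain_exp_le => x l; rewrite -lerBlDr.
rewrite e ?andbT; last by move=> x l; exact: le_trans (ler_norm _) (FG x l).
rewrite addrC lerBlDr addrC; apply: e => x l.
by apply: le_trans (ler_norm _) _; rewrite distrC.
Qed.

End ChainExpectation.

Lemma fin_bounded (R : realType) (I : finType) (f : I -> R) :
  exists2 B, 0 <= B & forall i, `|f i| <= B.
Proof.
exists (\sum_i `|f i|) => [|i]; first exact: sumr_ge0.
by rewrite (bigD1 i) //= lerDl sumr_ge0.
Qed.

Section CentralLimit.
Context {R : realType} {X : finType}.
Variables (W g : X -> X -> R) (P l0 h h2 : X -> R) (D V : R).
Hypothesis hW : is_transition_matrix W.
Hypothesis hP : is_distribution P.
Hypothesis V0 : 0 <= V.
Hypothesis hh : forall xb, \sum_x W x xb * (g x xb + h x) = D + h xb.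
Let m x xb := g x xb - D + h x - h xb.
Hypothesis hh2 : forall xb,
  \sum_x W x xb * m x xb ^+ 2 + \sum_x W x xb * h2 x = V + h2 xb.

Let W_m xb : \sum_x W x xb * m x xb = 0.
Proof.
rewrite (eq_bigr (fun x => W x xb * (g x xb + h x) - (D + h xb) * W x xb)); last first.
  by move=> x _; rewrite /m; ring.
by rewrite sumrB hh -mulr_sumr hW.2 mulr1 subrr.
Qed.

Lemma sum_W_le (f : X -> R) xb c : (forall x, `|f x| <= c) ->
  `|\sum_x W x xb * f x| <= c.
Proof.
move=> fc; apply: (le_trans (ler_norm_sum _ _ _)).
rewrite -[leRHS]mulr1 -(hW.2 xb) mulr_sumr; apply: ler_sum => x _.
by rewrite normrM (ger0_norm (hW.1 x xb)) mulrC ler_wpM2r //; exact: hW.1.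
Qed.

Variables (y dlt : R).
Hypothesis dlt0 : 0 < dlt.

(* One step of the chain is matched with a time step [V r^2] of the heat flow;
   the corrector [r^2/2 * h2 * p2] replaces the conditional variance of the
   increment by its ergodic average [V]. *)
Lemma clt_heat : exists C, forall (N : nat) (r : R), (0 < N)%N ->
  r = (Num.sqrt N%:R)^-1 ->
  `|chain_exp W g P l0 N (fun x l => heat y dlt (r * (l - N%:R * D + h x)))
    - heat y (dlt + V) 0| <= C * r.
Proof.
have [p1 [p2 [C C0 heatP]]] := heat_expansion y dlt0.
have [B1 B10 hB1] := fin_bounded (fun xx : X * X => m xx.1 xx.2).
have [B2 B20 hB2] := fin_bounded h2.
have [B3 B30 hB3] := fin_bounded (fun x => l0 x + h x).
pose C1 := C * (B1 ^+ 3 + B2 * B1 + V ^+ 2 + B2 * V).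
exists (C1 + C * B2 + C * B2 + C * B3) => N r N0 rE.
have Nr : N%:R * r ^+ 2 = 1.
  by rewrite rE exprVn sqr_sqrtr ?ler0n // divff // pnatr_eq0 -lt0n.
have r0 : 0 < r by rewrite rE invr_gt0 sqrtr_gt0 ltr0n.
have r1 : r <= 1.
  rewrite rE invf_le1 ?sqrtr_gt0 ?ltr0n // -[leLHS]sqrtr1; apply: ler_wsqrtr.
  by rewrite ler1n.
have r2r : r ^+ 2 <= r by rewrite expr2 ler_piMl // ltW.
(* Remaining time: since [N%:R * r ^+ 2 = 1], it decreases from [dlt + V] at step 0 to [dlt] at step
   [N]. *)
pose s k := dlt + V * (N%:R - k%:R) * r ^+ 2.
pose z k x l := r * (l - k%:R * D + h x).
pose G k x l := heat y (s k) (z k x l) + r ^+ 2 / 2 * h2 x * p2 (s k) (z k x l).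
have sS k : s k = s k.+1 + V * r ^+ 2 by rewrite /s -[k.+1]addn1 natrD; ring.
have s_ge k : (k <= N)%N -> dlt <= s k.
  by move=> kN; rewrite lerDl !mulr_ge0 ?subr_ge0 ?ler_nat // ltW.
have sN : s N = dlt by rewrite /s subrr mulr0 mul0r addr0.
have s0 : s 0%N = dlt + V by rewrite /s subr0 -mulrA Nr mulr1.
have corr k x l : (k <= N)%N ->
    `|r ^+ 2 / 2 * h2 x * p2 (s k) (z k x l)| <= C * B2 * r.
  move=> /s_ge sk; have [_ _ _ pC _] := heatP (s k) (z k x l) sk.
  rewrite (_ : C * B2 * r = r * B2 * C); last by ring.
  rewrite normrM; apply: ler_pM => //.
  rewrite normrM; apply: ler_pM => //.
  by rewrite ger0_norm ?divr_ge0 ?sqr_ge0 // ler_pdivrMr //; lra.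
have step k xb l : (k < N)%N ->
    `|\sum_x W x xb * G k.+1 x (l + g x xb) - G k xb l| <= C1 * r ^+ 3.
  move=> kN; have sk := s_ge _ kN.
  have zS x : z k.+1 x (l + g x xb) = z k xb l + r * m x xb.
    by rewrite /z /m -[k.+1]addn1 natrD; ring.
  rewrite /G (sS k); under eq_bigr do rewrite zS.
  move: (s k.+1) (z k xb l) sk => t w tdlt.
  have [T2 T1 [L2 L1] _ _] := heatP t w tdlt.
  set q1 := p1 t w in T2 *; set q2 := p2 t w in T2 T1 L2 L1 *.
  (* [a] and [c] are the Taylor remainders in space and time, [b] and [e] the variations of [p2] in
     the corrector. Each contribution is of order [r ^+ 3], so the [N] steps together cost order
     [r]. *)
  pose a x := heat y t (w + r * m x xb) - heat y t w - r * m x xb * q1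
      - (r * m x xb) ^+ 2 / 2 * q2.
  pose b x := p2 t (w + r * m x xb) - q2.
  have Vr : 0 <= V * r ^+ 2 by rewrite mulr_ge0 // sqr_ge0.
  pose c := heat y (t + V * r ^+ 2) w - heat y t w - V * r ^+ 2 / 2 * q2.
  pose e := p2 (t + V * r ^+ 2) w - q2.
  have rm x : `|r * m x xb| <= r * B1.
    by rewrite normrM gtr0_norm // ler_pM2l //; exact: hB1 (x, xb).
  have aC x : `|a x| <= C * B1 ^+ 3 * r ^+ 3.
    apply: (le_trans (T2 _)); rewrite -mulrA ler_wpM2l // -exprMn.
    by rewrite [B1 * r]mulrC lerXn2r ?nnegrE ?mulr_ge0 // ltW.
  have bC x : `|r ^+ 2 / 2 * h2 x * b x| <= C * (B2 * B1) * r ^+ 3.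
    rewrite normrM; apply: (@le_trans _ _ (r ^+ 2 * B2 * (C * (r * B1)))).
      apply: ler_pM => //; last by apply: (le_trans (L2 _)); rewrite ler_wpM2l.
      rewrite normrM; apply: ler_pM => //.
      by rewrite ger0_norm ?divr_ge0 ?sqr_ge0 // ler_pdivrMr //; have := sqr_ge0 r; lra.
    by rewrite [leLHS](_ : _ = C * (B2 * B1) * r ^+ 3) //; ring.
  have cC : `|c| <= C * V ^+ 2 * r ^+ 3.
    apply: (le_trans (T1 _ Vr)); rewrite exprMn -mulrA; apply: ler_wpM2l => //.
    apply: ler_wpM2l; first exact: sqr_ge0.
    rewrite -exprM [leRHS](_ : _ = r ^+ 3 * 1) ?mulr1 // (exprSr r 3).
    by rewrite -[leRHS]mulr1; apply: ler_wpM2l => //; rewrite exprn_ge0 // ltW.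
  have eC : `|r ^+ 2 / 2 * h2 xb * e| <= C * (B2 * V) * r ^+ 3.
    rewrite normrM; apply: (@le_trans _ _ (r ^+ 2 * B2 * (C * (V * r)))).
      apply: ler_pM => //; last first.
        apply: (le_trans (L1 _ Vr)); apply: ler_wpM2l => //.
        exact: ler_wpM2l.
      rewrite normrM; apply: ler_pM => //.
      by rewrite ger0_norm ?divr_ge0 ?sqr_ge0 // ler_pdivrMr //; have := sqr_ge0 r; lra.
    by rewrite [leLHS](_ : _ = C * (B2 * V) * r ^+ 3) //; ring.
  (* The linear term vanishes by [W_m]. By [hh2] the quadratic term and the corrector add up to
     [V + h2 xb]: the [V] part is the time step of the flow, the [h2 xb] part is the corrector
     before the step. *)
  have -> : \sum_x W x xb * (heat y t (w + r * m x xb) +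
        r ^+ 2 / 2 * h2 x * p2 t (w + r * m x xb))
      - (heat y (t + V * r ^+ 2) w + r ^+ 2 / 2 * h2 xb * p2 (t + V * r ^+ 2) w)
    = \sum_x W x xb * a x + \sum_x W x xb * (r ^+ 2 / 2 * h2 x * b x) - c
      - r ^+ 2 / 2 * h2 xb * e.
    rewrite (eq_bigr (fun x => heat y t w * W x xb + (r * q1 * (W x xb * m x xb) +
       (r ^+ 2 / 2 * q2 * (W x xb * m x xb ^+ 2) + (r ^+ 2 / 2 * q2 * (W x xb * h2 x) +
       (W x xb * a x + W x xb * (r ^+ 2 / 2 * h2 x * b x))))))); last first.
      by move=> x _; rewrite /a /b; field.
    rewrite !big_split /= -!mulr_sumr W_m hW.2 mulr1 mulr0 add0r.
    rewrite (addrA (_ * \sum_x W x xb * m x xb ^+ 2)) -mulrDr hh2 /c /e.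
    by field.
  rewrite (_ : C1 * r ^+ 3 = C * B1 ^+ 3 * r ^+ 3 + C * (B2 * B1) * r ^+ 3
    + C * V ^+ 2 * r ^+ 3 + C * (B2 * V) * r ^+ 3); last by rewrite /C1; ring.
  apply: (le_trans (ler_normB _ _)).
  apply: lerD => //; apply: (le_trans (ler_normB _ _)); apply: lerD => //.
  by apply: (le_trans (ler_normD _ _)); apply: lerD; apply: sum_W_le.
pose J k := chain_exp W g P l0 k (G k).
have tele k : (k <= N)%N -> `|J k - J 0%N| <= C1 * r ^+ 3 * k%:R.
  elim: k => [|k IH] kN; first by rewrite subrr normr0 mulr0.
  rewrite -(subrK (J k) (J k.+1)) -addrA; apply: (le_trans (ler_normD _ _)).
  rewrite -[k.+1]add1n natrD mulrDr mulr1; apply: lerD; last exact/IH/ltnW.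
  apply: (@chain_exp_dist _ _ W g P l0 hW hP k
    (fun xb l => \sum_x W x xb * G k.+1 x (l + g x xb)) (G k)).
  by move=> xb l; exact: step.
have JN : `|chain_exp W g P l0 N (fun x l => heat y dlt (r * (l - N%:R * D + h x)))
    - J N| <= C * B2 * r.
  apply: chain_exp_dist => // x l; rewrite /G sN -/(z N x l) opprD addNKr normrN.
  by rewrite -{1}sN; exact: corr.
have J0 : `|J 0%N - heat y (dlt + V) 0| <= C * B2 * r + C * B3 * r.
  have -> : J 0%N = chain_exp W g P l0 0 (fun x l => G 0%N x (l0 x)) by [].
  rewrite -[X in _ - X](@chain_exp_cst _ _ W g P l0 hW hP 0).
  apply: chain_exp_dist => // x _; rewrite /G.
  have -> : forall A Bb Cc : R, A + Bb - Cc = Bb + (A - Cc) by move=> *; ring.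
  apply: (le_trans (ler_normD _ _)); apply: lerD; first exact: corr.
  have [_ _ _ _ L0] := heatP (s 0%N) 0 (s_ge 0%N (leq0n _)).
  rewrite -s0 -[z _ _ _]add0r; apply: (le_trans (L0 _)).
  have -> : z 0%N x (l0 x) = r * (l0 x + h x) by rewrite /z mul0r subr0.
  rewrite normrM gtr0_norm // -mulrA [B3 * r]mulrC; apply: ler_wpM2l => //.
  by apply: ler_wpM2l; [exact: ltW|exact: hB3].
have rN : C1 * r ^+ 3 * N%:R = C1 * r.
  have -> : C1 * r ^+ 3 * N%:R = C1 * r * (N%:R * r ^+ 2) by ring.
  by rewrite Nr mulr1.
have := tele N (leqnn _); rewrite rN => tN.
set E := chain_exp _ _ _ _ _ _ in JN *.
have -> : E - heat y (dlt + V) 0 = (E - J N) + (J N - J 0%N) + (J 0%N - heat y (dlt + V) 0).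
  by ring.
apply: (le_trans (ler_normD _ _)); rewrite [leRHS](_ : _ =
  (C * B2 * r + C1 * r) + (C * B2 * r + C * B3 * r)); last by ring.
by apply: lerD => //; apply: (le_trans (ler_normD _ _)); exact: lerD.
Qed.

End CentralLimit.

(** * Hypothesis testing *)

Section NeymanPearson.
Context {R : realType} {Y : finType}.
Variables (Q1 Q0 L : Y -> R) (eps : R).
Hypothesis hQ1 : is_distribution Q1.
Hypothesis hQ0 : is_distribution Q0.
Hypothesis QL : forall y, Q1 y = Q0 y * expR (L y).
Hypothesis eps0 : 0 <= eps.

Let betas := [set b | exists T : Y -> R,
    [/\ is_test T, \sum_y Q1 y * T y <= eps &
        b = \sum_y Q0 y * (1 - T y)]].

Let betas_ge0 b : betas b -> 0 <= b.
Proof.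
move=> [T [hT _ ->]]; apply: sumr_ge0 => y _; apply: mulr_ge0; first exact: hQ0.1.
by rewrite subr_ge0; have /andP[] := hT y.
Qed.

(** Use the likelihood-ratio test that equals 1 on [L <= t]; off this event [Q0] is at most
    [expR (- t)] times [Q1]. *)
Lemma beta_le t : \sum_y Q1 y * (L y <= t)%R%:R <= eps ->
  beta eps Q1 Q0 <= expR (- t).
Proof.
move=> hL; apply: (@le_trans _ _ (\sum_y Q0 y * (1 - (L y <= t)%R%:R))).
  apply: ge_inf; first by exists 0 => b /betas_ge0.
  exists (fun y => (L y <= t)%R%:R); split => // y.
  by rewrite ler0n lern1 leq_b1.
have -> : expR (- t) = \sum_y Q1 y * expR (- t) by rewrite -mulr_suml hQ1.2 mul1r.
apply: ler_sum => y _.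
rewrite QL -mulrA -expRD ler_wpM2l ?hQ0.1 //.
case: (lerP (L y) t) => Lt; rewrite ?mulr1n ?mulr0n; first by rewrite subrr expR_ge0.
rewrite subr0 -[leLHS]expR0 ler_expR; lra.
Qed.

(** For any test, keep only the part of the error on [L <= t], where [Q0] is at least [expR (- t)]
    times [Q1]; there [1 - T] has [Q1]-mass at least that of the event minus [eps]. *)
Lemma beta_ge t :
  expR (- t) * (\sum_y Q1 y * (L y <= t)%R%:R - eps) <= beta eps Q1 Q0.
Proof.
apply: lb_le_inf.
  exists (\sum_y Q0 y * (1 - 0)), (fun=> 0); split => [y||//].
    by rewrite lexx ler01.
  by under eq_bigr do rewrite mulr0; rewrite sumr_const mul0rn.
move=> b [T [hT hTe ->]].
apply: (@le_trans _ _ (expR (- t) * (\sum_y Q1 y * (1 - T y) * (L y <= t)%R%:R))).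
  rewrite ler_wpM2l ?expR_ge0 // lerBlDr; apply: (le_trans _ (lerD (lexx _) hTe)).
  rewrite -big_split /=; apply: ler_sum => y _.
  have Q10 := hQ1.1 y; have /andP[T0 T1] := hT y.
  have h : 0 <= Q1 y * T y by exact: mulr_ge0.
  by case: (lerP (L y) t) => _; rewrite ?mulr1n ?mulr0n ?mulr1 ?mulr0 ?add0r //; lra.
rewrite mulr_sumr; apply: ler_sum => y _; rewrite QL.
have /andP[T0 T1] := hT y; have Q00 := hQ0.1 y.
have h : 0 <= Q0 y * (1 - T y) by rewrite mulr_ge0 // subr_ge0.
case: (lerP (L y) t) => Lt; rewrite ?mulr1n ?mulr0n; last by rewrite !mulr0.
rewrite mulr1 [leLHS](_ : _ = Q0 y * (1 - T y) * expR (L y - t)); last by rewrite expRD; ring.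
by rewrite ler_piMr // -[leRHS]expR0 ler_expR; lra.
Qed.

End NeymanPearson.

(** * Path laws as iterated one-step expectations *)

Section MarkovLaw.
Context {R : realType} {X : finType}.
Variables (W g : X -> X -> R) (P l0 : X -> R).

Definition path_sum n (s : {ffun 'I_n.+1 -> X}) : R :=
  l0 (s ord0) + \sum_(k < n) g (s (lift ord0 k)) (s (widen_ord (leqnSn n) k)).

Let ext n (s : {ffun 'I_n.+1 -> X}) (x : X) : {ffun 'I_n.+2 -> X} :=
  [ffun i => if unlift ord_max i is Some j then s j else x].

Let extl n (s : {ffun 'I_n.+1 -> X}) x (i : 'I_n.+2) (j : 'I_n.+1) :
  i = j :> nat -> ext s x i = s j.
Proof.
move=> ij; have -> : i = lift ord_max j by apply: val_inj; rewrite [RHS]lift_max -ij.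
by rewrite ffunE liftK.
Qed.

Let extr n (s : {ffun 'I_n.+1 -> X}) x (i : 'I_n.+2) :
  i = n.+1 :> nat -> ext s x i = x.
Proof.
move=> ij; have -> : i = ord_max by apply: val_inj.
by rewrite ffunE unlift_none.
Qed.

Lemma markov_law_ext n (s : {ffun 'I_n.+1 -> X}) x :
  markov_law W P n.+1 (ext s x) = markov_law W P n s * W x (s ord_max).
Proof.
rewrite /markov_law big_ord_recr /= mulrA (@extl n s x ord0 ord0 erefl).
congr (_ * _ * _).
  by apply: eq_bigr => k _; congr W; exact: extl.
by congr W; [exact: extr|exact: extl].
Qed.

Lemma path_sum_ext n (s : {ffun 'I_n.+1 -> X}) x :
  path_sum (ext s x) = path_sum s + g x (s ord_max).
Proof.
rewrite /path_sum big_ord_recr /= addrA (@extl n s x ord0 ord0 erefl).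
congr (_ + _ + _).
  by apply: eq_bigr => k _; congr g; exact: extl.
by congr g; [exact: extr|exact: extl].
Qed.

(** Induction on the length: a path is a shorter path extended by its last state, and summing over
    that state is one step of [chain_exp]. *)
Lemma markov_law_chain_exp n (F : X -> R -> R) :
  \sum_s markov_law W P n s * F (s ord_max) (path_sum s) =
  chain_exp W g P l0 n F.
Proof.
elim: n F => [|n IH] F /=.
  rewrite (reindex (fun x : X => [ffun=> x] : {ffun 'I_1 -> X})) /=; last first.
    exists (fun s : {ffun 'I_1 -> X} => s ord0) => [x _|s _]; first by rewrite ffunE.
    by apply/ffunP => i; rewrite ffunE (ord1 i).
  apply: eq_bigr => x _.
  by rewrite /markov_law /path_sum !big_ord0 !ffunE mulr1 addr0.
rewrite -IH; under [RHS]eq_bigr do rewrite mulr_sumr.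
rewrite pair_big /=.
pose res (s : {ffun 'I_n.+2 -> X}) : {ffun 'I_n.+1 -> X} * X :=
  ([ffun j => s (lift ord_max j)], s ord_max).
rewrite (reindex (fun sx : {ffun 'I_n.+1 -> X} * X => ext sx.1 sx.2)) /=; last first.
  exists res => [[s x] _|s _] /=.
    rewrite /res extr //; congr (_, _); apply/ffunP => j.
    by rewrite ffunE; apply: extl; rewrite lift_max.
  apply/ffunP => i; rewrite ffunE; case: unliftP => [j ->|->] //=.
  by rewrite ffunE.
apply: eq_bigr => [[s x] _] /=.
by rewrite markov_law_ext path_sum_ext extr // mulrA.
Qed.

End MarkovLaw.

Lemma markov_law_distribution (R : realType) (X : finType) (W : X -> X -> R) (P : X -> R) n :
  is_transition_matrix W -> is_distribution P -> is_distribution (markov_law W P n).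
Proof.
move=> hW hP; split.
  move=> s; rewrite /markov_law mulr_ge0 ?hP.1 //.
  by apply: prodr_ge0 => k _; exact: hW.1.
rewrite -[RHS](@chain_exp_cst _ _ W (fun _ _ => 0) P (fun=> 0) hW hP n).
rewrite -markov_law_chain_exp; apply: eq_bigr => s _; by rewrite mulr1.
Qed.

Lemma markov_law_path_sum (R : realType) (X : finType) (W0 W1 g : X -> X -> R)
    (P0 P1 l0 : X -> R) n s :
  (forall x xb, W1 x xb = W0 x xb * expR (g x xb)) ->
  (forall x, P1 x = P0 x * expR (l0 x)) ->
  markov_law W1 P1 n s = markov_law W0 P0 n s * expR (path_sum g l0 s).
Proof.
move=> hW hP; rewrite /markov_law /path_sum hP expRD expR_sum mulrACA -big_split /=.
by congr (_ * _); apply: eq_bigr => k _; exact: hW.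
Qed.

(* Smoothing scale [k] for which replacing the variance [V] by [k^2 + V] costs
   less than the slack [eta / 2]; the strict gain [c] does not depend on [k]. *)
Lemma smoothing_scale (R : realType) (V q eta K : R) :
  0 <= V -> 0 < eta -> 0 < K ->
  let c := eta / (4 * (Num.sqrt V + 1)) in
  exists2 k, 0 < k &
  [/\ K <= eta / 4 / k,
      (Num.sqrt V * q - eta / 2) / Num.sqrt (k ^+ 2 + V) <= q - c &
      q + c <= (Num.sqrt V * q + eta / 2) / Num.sqrt (k ^+ 2 + V)].
Proof.
move=> V0 eta0 K0 c.
set v := Num.sqrt V; have v0 : 0 <= v by exact: sqrtr_ge0.
have vV : v ^+ 2 = V by rewrite sqr_sqrtr.
have c0 : 0 < c by rewrite divr_gt0 // mulr_gt0 // ltr_pwDr.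
have cE : c * (v + 1) = eta / 4 by rewrite /c -/v; field; lra.
(* Chosen so that [k = (1 + M)^-1] satisfies [k <= 1] and [k * (|q| + K) <= eta / 4]. This yields
   the tail condition, and also controls [q * (s - v)] because [s] lies between [v] and [v + k]. *)
pose M := 4 * (`|q| + K) / eta.
have M0 : 0 < M by rewrite divr_gt0 // mulr_gt0 // ltr_wpDl.
pose k := (1 + M)^-1.
have M10 : 0 < 1 + M by rewrite addr_gt0.
have k0 : 0 < k by rewrite invr_gt0.
have kM : k * (1 + M) = 1 by rewrite mulVf // gt_eqF.
have ME : M * eta = 4 * (`|q| + K) by rewrite divfK // gt_eqF.
have kM1 : k * M <= 1 by nra.
have k1 : k <= 1 by nra.
have kqK : k * (`|q| + K) <= eta / 4.
  have -> : k * (`|q| + K) = k * M * eta / 4 by rewrite -mulrA -mulrA [M * _]mulrA ME; field.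
  by rewrite ler_pM2r // ler_piMl // ltW.
have q0 := normr_ge0 q.
have kqe : k * `|q| <= eta / 4 by nra.
have kKe : K * k <= eta / 4 by nra.
set s := Num.sqrt (k ^+ 2 + V).
have s2 : s ^+ 2 = k ^+ 2 + V by rewrite sqr_sqrtr // addr_ge0 // sqr_ge0.
have s0 : 0 < s by rewrite sqrtr_gt0 ltr_pwDl // exprn_gt0.
have vs : v <= s by apply: ler_wsqrtr; rewrite lerDr sqr_ge0.
have sv : s <= v + k.
  rewrite -ler_sqr ?nnegrE ?addr_ge0 ?(ltW k0) ?(ltW s0) // s2 sqrrD vV.
  have : 0 <= v * k by rewrite mulr_ge0 // ltW.
  by rewrite mulr2n; move: (v * k) (k ^+ 2) => a b; lra.
have cs : c * s <= eta / 4 by rewrite -cE ler_pM2l //; lra.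
have qs : `|q * (s - v)| <= eta / 4.
  rewrite normrM [`|s - v|]ger0_norm ?subr_ge0 //; apply: le_trans kqe.
  by rewrite mulrC ler_wpM2r //; lra.
move: qs; rewrite ler_norml => /andP[qs1 qs2].
exists k => //; split.
- by rewrite ler_pdivlMr.
- by rewrite -/s ler_pdivrMr //; lra.
- by rewrite -/s ler_pdivlMr //; lra.
Qed.

Lemma near_sqrt_small (R : realType) (C e : R) : 0 < e ->
  \forall n \near \oo, (0 < n)%N /\ C * (Num.sqrt n%:R)^-1 <= e.
Proof.
move=> e0; pose M := (`|C| / e) ^+ 2.
near=> n.
have n0 : (0 < n)%N by near: n; exact: nbhs_infty_gt.
have sn0 : 0 < Num.sqrt n%:R :> R by rewrite sqrtr_gt0 ltr0n.
split=> //; rewrite ler_pdivrMr //; apply: (le_trans (ler_norm C)).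
rewrite mulrC -ler_pdivrMr // -[leLHS]ger0_norm ?divr_ge0 ?(ltW e0) // -sqrtr_sqr.
apply: ler_wsqrtr; near: n; exact: nbhs_infty_ger.
Unshelve. all: by end_near. Qed.

(** * Quantile bounds for the additive functional *)

Section Quantiles.
Context {R : realType} {X : finType}.
Variables (W g : X -> X -> R) (P l0 h h2 : X -> R) (D V : R).
Hypothesis hW : is_transition_matrix W.
Hypothesis hP : is_distribution P.
Hypothesis V0 : 0 <= V.
Hypothesis hh : forall xb, \sum_x W x xb * (g x xb + h x) = D + h xb.
Hypothesis hh2 : forall xb,
  \sum_x W x xb * (g x xb - D + h x - h xb) ^+ 2 + \sum_x W x xb * h2 x
  = V + h2 xb.

Let cdf n t := chain_exp W g P l0 n (fun _ l => (l <= t)%R%:R).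

Variables (q eta : R).
Hypothesis eta0 : 0 < eta.

Let c : R := eta / (4 * (Num.sqrt V + 1)).

Let c0 : 0 < c.
Proof. by rewrite divr_gt0 // mulr_gt0 // ltr_pwDr // sqrtr_ge0. Qed.

(** Up to [d], the indicator lies below a smoothed one whose threshold is higher by [eta / 2]: one
    quarter of [eta] absorbs [r * h x], the other the Gaussian tail at scale [k]. A second [d] pays
    for the convergence error. *)
Lemma chain_cdf_upper e : Phi (q - c) < e ->
  \forall n \near \oo,
    cdf n (n%:R * D + Num.sqrt n%:R * (Num.sqrt V * q - eta)) <= e.
Proof.
move=> he; pose d := (e - Phi (q - c)) / 2.
have d0 : 0 < d by rewrite divr_gt0 // subr_gt0.
have [K K0 [hK _]] := Phi_tails d0.
have [k k0 [kK kq _]] := smoothing_scale q V0 eta0 K0.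
have k20 : 0 < k ^+ 2 by rewrite exprn_gt0.
have [H H0 hH] := fin_bounded h.
set y := Num.sqrt V * q - eta / 2 in kq.
have [C hC] := clt_heat l0 hW hP V0 hh hh2 y k20.
have e40 : 0 < eta / 4 by rewrite divr_gt0.
near=> n.
have [n0 Cn] : (0 < n)%N /\ C * (Num.sqrt n%:R)^-1 <= d by near: n; exact: near_sqrt_small.
have [_ Hn] : (0 < n)%N /\ H * (Num.sqrt n%:R)^-1 <= eta / 4 by near: n; exact: near_sqrt_small.
have := hC n _ n0 erefl; set r := (Num.sqrt n%:R)^-1 in Cn Hn *.
have sn0 : 0 < Num.sqrt n%:R :> R by rewrite sqrtr_gt0 ltr0n.
have r0 : 0 < r by rewrite invr_gt0.
rewrite ler_norml => /andP[_ hE].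
have le_heat : cdf n (n%:R * D + Num.sqrt n%:R * (Num.sqrt V * q - eta)) <=
   chain_exp W g P l0 n (fun x l => heat y (k ^+ 2) (r * (l - n%:R * D + h x)) + d).
  apply: chain_exp_le => // x l; case: (lerP l _) => /= hl; rewrite ?mulr1n ?mulr0n; last first.
    by rewrite addr_ge0 ?Phi_ge0 // ltW.
  suff : Phi K <= heat y (k ^+ 2) (r * (l - n%:R * D + h x)) by lra.
  apply: Phi_le; rewrite sqrtr_sqr gtr0_norm //; apply: (le_trans kK).
  rewrite ler_pM2r ?invr_gt0 //.
  have hx : r * h x <= eta / 4.
    apply: (le_trans _ Hn); rewrite mulrC ler_pM2r //.
    exact: le_trans (ler_norm _) (hH x).
  have hr : r * (l - n%:R * D) <= Num.sqrt V * q - eta.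
    by rewrite mulrC ler_pdivrMr // lerBlDr addrC [_ * Num.sqrt n%:R]mulrC.
  by rewrite mulrDr /y; lra.
apply: (le_trans le_heat); rewrite chain_expD (chain_exp_cst _ _ hW hP).
have hP' : heat y (k ^+ 2 + V) 0 <= Phi (q - c) by apply: Phi_le; rewrite subr0.
move: hE Cn hP'; rewrite -/r /d; lra.
Unshelve. all: by end_near. Qed.

(** Mirror image of the upper bound. The margin [rho] does not depend on [n], so that its logarithm
    is negligible against [sqrt n] in the converse bound. *)
Lemma chain_cdf_lower e : e < Phi (q + c) ->
  exists2 rho, 0 < rho & \forall n \near \oo,
    e + rho <= cdf n (n%:R * D + Num.sqrt n%:R * (Num.sqrt V * q + eta)).
Proof.
(* Of the four units, one goes to the tail, one to the convergence error and one to [rho]. *)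
move=> he; pose d := (Phi (q + c) - e) / 4.
have d0 : 0 < d by rewrite divr_gt0 // subr_gt0.
have [K K0 [_ hK]] := Phi_tails d0.
have [k k0 [kK _ kq]] := smoothing_scale q V0 eta0 K0.
have k20 : 0 < k ^+ 2 by rewrite exprn_gt0.
have [H H0 hH] := fin_bounded h.
set y := Num.sqrt V * q + eta / 2 in kq.
have [C hC] := clt_heat l0 hW hP V0 hh hh2 y k20.
have e40 : 0 < eta / 4 by rewrite divr_gt0.
exists d => //; near=> n.
have [n0 Cn] : (0 < n)%N /\ C * (Num.sqrt n%:R)^-1 <= d by near: n; exact: near_sqrt_small.
have [_ Hn] : (0 < n)%N /\ H * (Num.sqrt n%:R)^-1 <= eta / 4 by near: n; exact: near_sqrt_small.
have := hC n _ n0 erefl; set r := (Num.sqrt n%:R)^-1 in Cn Hn *.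
have sn0 : 0 < Num.sqrt n%:R :> R by rewrite sqrtr_gt0 ltr0n.
have r0 : 0 < r by rewrite invr_gt0.
rewrite ler_norml => /andP[hE _].
have heat_le : chain_exp W g P l0 n (fun x l => heat y (k ^+ 2) (r * (l - n%:R * D + h x)))
   <= chain_exp W g P l0 n (fun _ l =>
        (l <= n%:R * D + Num.sqrt n%:R * (Num.sqrt V * q + eta))%R%:R + d).
  apply: chain_exp_le => // x l; case: (lerP l _) => /= hl; rewrite ?mulr1n ?mulr0n.
    by have := Phi_le1 ((y - r * (l - n%:R * D + h x)) / Num.sqrt (k ^+ 2)); rewrite /heat; lra.
  rewrite add0r; apply: (le_trans _ (ltW hK)).
  apply: Phi_le; rewrite sqrtr_sqr gtr0_norm //; apply: (@le_trans _ _ (- (eta / 4 / k))).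
    rewrite -[leRHS]mulNr ler_pM2r ?invr_gt0 //.
    have hx : - (eta / 4) <= r * h x.
      rewrite lerNl -mulrN; apply: (le_trans _ Hn); rewrite mulrC ler_pM2r //.
      by apply: le_trans (ler_norm _) _; rewrite normrN; exact: hH.
    have hr : Num.sqrt V * q + eta <= r * (l - n%:R * D).
      by rewrite [r * _]mulrC ler_pdivlMr // lerBrDl [_ * Num.sqrt n%:R]mulrC ltW.
    by rewrite mulrDr /y; lra.
  by rewrite lerN2.
move: heat_le; rewrite chain_expD (chain_exp_cst _ _ hW hP) -/(cdf _ _) => heat_le.
have hP' : Phi (q + c) <= heat y (k ^+ 2 + V) 0 by apply: Phi_le; rewrite subr0.
move: hE Cn hP' heat_le; rewrite -/r /d; lra.
Unshelve. all: by end_near. Qed.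

End Quantiles.

(** * Identification of the drift and variance of the log-likelihood ratio *)

Section LogLikelihood.
Context {R : realType} {X : finType}.
Variables (W0 W1 : X -> X -> R).
Hypothesis hW0 : is_transition_matrix W0.
Hypothesis hW1 : is_transition_matrix W1.
Hypothesis irr1 : irreducible W1.
Hypothesis suppW : same_support2 W0 W1.
Hypothesis X0 : (0 < #|X|)%N.

Let g x xb := ln (W1 x xb) - ln (W0 x xb).

Lemma expR_ln_ratio (a b : R) : 0 <= a -> 0 <= b -> (a != 0) = (b != 0) ->
  b = a * expR (ln b - ln a).
Proof.
move=> a0 b0 ab; have [ae|an] := eqVneq a 0.
  by move: ab; rewrite ae eqxx mul0r /= => /esym/negbT; rewrite negbK => /eqP.
have bn : b != 0 by rewrite -ab.
rewrite expRB !lnK ?posrE ?lt_def ?an ?bn //.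
by rewrite mulrC divfK.
Qed.

(** Taking [W1] as base absorbs the support test: off the common support both sides are 0, and the
    dependence on [t] is a plain exponential. *)
Let tiltedE t : tilted W0 (1 - t) W1 t = fun x xb => W1 x xb * expR ((t - 1) * g x xb).
Proof.
apply/funext => x; apply/funext => xb; rewrite /tilted suppW andbb.
case: ifPn => [n1|]; last by rewrite negbK => /eqP ->; rewrite mul0r.
have n0 : W0 x xb != 0 by rewrite suppW.
have p0 : 0 < W0 x xb by rewrite lt_def n0 hW0.1.
have p1 : 0 < W1 x xb by rewrite lt_def n1 hW1.1.
rewrite /powR (negPf n0) (negPf n1) -{2}(lnK p1) -!expRD; congr expR.
by rewrite /g; ring.
Qed.

Let tiltedC s : tilted W1 (1 + s) W0 (- s) = tilted W0 (1 - (1 + s)) W1 (1 + s).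
Proof.
apply/funext => x; apply/funext => xb; rewrite /tilted andbC mulrC.
by rewrite opprD addrA subrr add0r.
Qed.

Let sum_enum (f : X -> R) : \sum_(i < #|X|) f (enum_val i) = \sum_x f x.
Proof.
rewrite [RHS](reindex (fun i : 'I_#|X| => enum_val i)) //.
exact: onW_bij (enum_val_bij X).
Qed.

Lemma log_likelihood_cumulants : exists h h2 : X -> R,
  [/\ 0 <= derive1n 2 (phi W0 W1) 1,
      forall xb, \sum_x W1 x xb * (g x xb + h x) = rel_entropy W1 W0 + h xb &
      forall xb, \sum_x W1 x xb * (g x xb - rel_entropy W1 W0 + h x - h xb) ^+ 2
        + \sum_x W1 x xb * h2 x = derive1n 2 (phi W0 W1) 1 + h2 xb].
Proof.
pose W := mx_of W1; pose G := mx_of g.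
pose A t : 'M[R]_#|X| := \matrix_(i, j) (W i j * expR ((t - 1) * G i j)).
pose lam t := perron_frobenius (tilted W0 (1 - t) W1 t).
have Wnn : nneg_mx W by move=> i j; rewrite mxE hW1.1.
have irrW : irreducible_mx W.
  move=> i j; have [k k0] := irr1 (enum_val i) (enum_val j).
  by rewrite /n_step !enum_valK => Wk; exists k.
have W1s : const_mx 1 *m W = const_mx 1 :> 'rV[R]_#|X|.
  apply/rowP => j; rewrite !mxE -[RHS](hW1.2 (enum_val j)) -sum_enum.
  by apply: eq_bigr => i _; rewrite !mxE mul1r.
have lamP t : is_perron_frobenius (A t) (lam t).
  have Ann : nneg_mx (A t) by move=> i j; rewrite mxE mulr_ge0 // expR_ge0.
  have irrA : irreducible_mx (A t).
    have E0 : pos_mx (\matrix_(i, j) expR ((t - 1) * G i j)).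
      by move=> i j; rewrite mxE expR_gt0.
    have := irreducible_mx_weight Wnn E0 irrW; congr irreducible_mx.
    by apply/matrixP => i j; rewrite !mxE.
  have [r [u [v [r0 uv]]]] := perron_exists X0 Ann irrA.
  have rP := perron_frobeniusP X0 Ann uv.
  rewrite /lam /perron_frobenius (_ : mx_of _ = A t); last first.
    by apply/matrixP => i j; rewrite !mxE tiltedE.
  (* The default value 0 of [perron_frobenius] cannot occur, since [r] satisfies the defining
     property. *)
  by case: xgetP => [z _ //|/(_ r)].
have phiE : phi W0 W1 = (fun t => ln (lam t)) by [].
have entE : rel_entropy W1 W0 = derive1 (fun s => ln (lam (1 + s))) 0.
  have E : (fun s : R => ln (perron_frobenius (tilted W1 (1 + s) W0 (- s)))) =
           (fun s => ln (lam (1 + s))) by apply/funext => s; rewrite tiltedC.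
  have := congr1 (fun F : R -> R => derive1 F 0) E; exact.
clearbody lam.
have [D [V [hm [h2m [dD dV V0 e1 e2]]]]] := tilted_perron X0 Wnn irrW W1s lamP.
have VE : derive1n 2 (phi W0 W1) 1 = V.
  by rewrite derive1nS derive1n1 phiE; exact: is_derive_derive1.
have DE : rel_entropy W1 W0 = D.
  have d1 : is_derive (0 : R) 1 (fun s : R => 1 + s) 1.
    apply: (is_derive_eq (is_deriveD (is_derive_cst (1 : R) (0 : R) 1) (is_derive_id (0 : R) 1))).
    by rewrite add0r.
  have d2 : is_derive (1 + 0 : R) 1 (fun t => ln (lam t)) D by rewrite addr0.
  by rewrite entE (is_derive_derive1 (is_derive_comp d2 d1)) mulr1.
exists (fun x => hm 0 (enum_rank x)), (fun x => h2m 0 (enum_rank x)).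
rewrite DE VE; split => // xb.
  rewrite -e1 -sum_enum; apply: eq_bigr => i _.
  by rewrite !mxE enum_rankK enum_valK.
rewrite -e2 -!sum_enum; congr (_ + _); apply: eq_bigr => i _.
  by rewrite !mxE enum_rankK enum_valK.
by rewrite !mxE enum_rankK enum_valK.
Qed.

End LogLikelihood.

Theorem theorem9p6 (R : realType) (X : finType)
    (W0 W1 : X -> X -> R) (P0 P1 : X -> R)
    (hW0 : is_transition_matrix W0) (hW1 : is_transition_matrix W1)
    (hne : W0 <> W1)
    (erg0 : ergodic W0) (erg1 : ergodic W1)
    (suppW : same_support2 W0 W1)
    (hP0 : is_distribution P0) (hP1 : is_distribution P1)
    (suppP : same_support P0 P1)
    (eps : R) (heps : 0 < eps < 1) :
  (fun n : nat =>
     - ln (beta eps (markov_law W1 P1 n) (markov_law W0 P0 n))) =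
  (fun n : nat =>
     n%:R * rel_entropy W1 W0 +
     Num.sqrt n%:R * Num.sqrt (derive1n 2 (phi W0 W1) 1) * Phi_inv eps)
  +o_\oo (fun n : nat => Num.sqrt n%:R : R).
Proof.
have /andP[eps0 eps1] := heps.
have X0 : (0 < #|X|)%N.
  rewrite lt0n; apply/negP => /eqP X0; have := hP0.2.
  rewrite big1 => [/esym/eqP|x _]; first by rewrite oner_eq0.
  by case: (fintype0 x X0).
pose g x xb := ln (W1 x xb) - ln (W0 x xb).
pose l0 x := ln (P1 x) - ln (P0 x).
have [h [h2 [V0 hh hh2]]] := log_likelihood_cumulants hW0 hW1 erg1.1 suppW X0.
set D := rel_entropy W1 W0 in hh hh2 *.
set V := derive1n 2 (phi W0 W1) 1 in V0 hh2 *.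
set q := Phi_inv eps.
have Phiq : Phi q = eps by exact: Phi_invK.
pose Q1 n := markov_law W1 P1 n; pose Q0 n := markov_law W0 P0 n.
have Q1d n : is_distribution (Q1 n) by exact: markov_law_distribution.
have Q0d n : is_distribution (Q0 n) by exact: markov_law_distribution.
pose L n (s : {ffun 'I_n.+1 -> X}) := path_sum g l0 s.
have QL n s : Q1 n s = Q0 n s * expR (L n s).
  apply: markov_law_path_sum => [x xb|x]; apply: expR_ln_ratio => //.
  - exact: hW0.1.
  - exact: hW1.1.
  - exact: hP0.1.
  - exact: hP1.1.
have cdfE n t : chain_exp W1 g P1 l0 n (fun _ l => (l <= t)%R%:R) =
    \sum_s Q1 n s * (L n s <= t)%R%:R.
  by rewrite -markov_law_chain_exp.
apply/eqaddoP => eta eta0.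
have eta20 : 0 < eta / 2 by rewrite divr_gt0.
(* An upper bound on the distribution function bounds [- ln beta] from below, with slack [eta]. The
   other side starts from [eta / 2], the remaining half being reserved for [- ln rho]. *)
have lower := chain_cdf_upper l0 hW1 hP1 V0 hh hh2 (q := q) eta0 (e := eps).
have upper := chain_cdf_lower l0 hW1 hP1 V0 hh hh2 (q := q) eta20 (e := eps).
have c_gt0 d : 0 < d -> 0 < d / (4 * (Num.sqrt V + 1)).
  by move=> d0; rewrite divr_gt0 // mulr_gt0 // ltr_pwDr // sqrtr_ge0.
have {}lower := lower ltac:(rewrite -Phiq; apply: Phi_lt; have := c_gt0 _ eta0; lra).
have [rho rho0 {}upper] := upper ltac:(rewrite -Phiq; apply: Phi_lt; have := c_gt0 _ eta20; lra).
near=> n.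
have lo : chain_exp W1 g P1 l0 n (fun _ l =>
    (l <= n%:R * D + Num.sqrt n%:R * (Num.sqrt V * q - eta))%R%:R) <= eps.
  by near: n.
have up : eps + rho <= chain_exp W1 g P1 l0 n (fun _ l =>
    (l <= n%:R * D + Num.sqrt n%:R * (Num.sqrt V * q + eta / 2))%R%:R).
  by near: n.
have sn0 : 0 <= Num.sqrt n%:R :> R by exact: sqrtr_ge0.
have [n0 rn] : (0 < n)%N /\ - ln rho * (Num.sqrt n%:R)^-1 <= eta / 2.
  by near: n; exact: near_sqrt_small.
have sn : 0 < Num.sqrt n%:R :> R by rewrite sqrtr_gt0 ltr0n.
rewrite ler_pdivrMr // in rn.
set S := Num.sqrt n%:R in lo up sn0 sn rn *.
have eps0' : 0 <= eps by exact: ltW.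
have b_le := beta_le (Q1d n) (Q0d n) (QL n) (eps := eps)
  (t := n%:R * D + S * (Num.sqrt V * q - eta)).
have b_ge := beta_ge (Q1d n) (Q0d n) (QL n) eps0' (n%:R * D + S * (Num.sqrt V * q + eta / 2)).
rewrite -cdfE in b_ge; rewrite -cdfE in b_le; have {}b_le := b_le lo.
set b := beta _ _ _ in b_le b_ge.
have b_ge' : expR (- (n%:R * D + S * (Num.sqrt V * q + eta / 2))) * rho <= b.
  by apply: le_trans b_ge; rewrite ler_wpM2l ?expR_ge0 // lerBrDl.
(* Positivity makes [ln b] a genuine logarithm, so that both bounds on [b] pass to it. *)
have b0 : 0 < b by apply: lt_le_trans b_ge'; rewrite mulr_gt0 ?expR_gt0.
have ln_le : ln b <= - (n%:R * D + S * (Num.sqrt V * q - eta)).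
  by rewrite -[leRHS]expRK ler_ln ?posrE ?expR_gt0.
have ln_ge : - (n%:R * D + S * (Num.sqrt V * q + eta / 2)) + ln rho <= ln b.
  rewrite -[X in X + _]expRK -lnM ?posrE ?expR_gt0 // ler_ln ?posrE //.
  by rewrite mulr_gt0 ?expR_gt0.
rewrite (_ : (_ - _) n = - ln b - (n%:R * D + S * Num.sqrt V * q)) //.
rewrite -/S (ger0_norm sn0) ler_norml.
by apply/andP; split; lra.
Unshelve. all: by end_near. Qed.
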